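(* If there exists a pair of orthogonal quantum Latin squares of order $6$, then there exists a pair $\Psi,\Phi$ of orthogonal quantum Latin squares of order $6$ in which $\Psi$ is classical.
   Context: A quantum Latin square (QLS) of order $n$ is an $n\times n$ matrix $\Psi=(\psi_{ij})_{1\le i,j\le n}$ whose entries are unit vectors in $\mathbb C^n$ such that the entries of each row and the entries of each column form an orthonormal basis of $\mathbb C^n$. Two QLS $\Psi=(\psi_{ij})$ and $\Phi=(\phi_{ij})$ of order $n$ are orthogonal if $\{\psi_{ij}\otimes\phi_{ij}: 1\le i,j\le n\}$ is an orthonormal basis of $\mathbb C^n\otimes\mathbb C^n$. A single QLS $\Psi$ of order $n$ is classical if there exist an orthonormal basis $e_1,\dots,e_n$ of $\mathbb C^n$ and a Latin square $L=(L_{ij})$ of order $n$ on the symbols $\{1,\dots,n\}$ such that each $\psi_{ij}$ is a scalar multiple of $e_{L_{ij}}$. *)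

(* Defs.v *)
From HB Require Import structures.
From mathcomp Require Import all_boot all_order all_algebra.
From mathcomp Require Import complex mxtens.
From mathcomp Require Import Rstruct.
Set Implicit Arguments. Unset Strict Implicit. Unset Printing Implicit Defensive.
Import Order.TTheory GRing.Theory Num.Theory.
Local Open Scope ring_scope.

Definition Cplx : numClosedFieldType := (Rdefinitions.R)[i].

Definition cdot (m : nat) (u v : 'rV[Cplx]_m) : Cplx :=
  \sum_(k < m) (u 0 k)^* * v 0 k.

Definition unit_vec (m : nat) (u : 'rV[Cplx]_m) : Prop := cdot u u = 1.

Definition is_onb (I : finType) (m : nat) (f : I -> 'rV[Cplx]_m) : Prop :=
  (forall i j, cdot (f i) (f j) = (i == j)%:R) /\
  (forall v : 'rV[Cplx]_m, exists c : I -> Cplx, v = \sum_(i : I) c i *: f i).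

Definition ktens (m n : nat) (u : 'rV[Cplx]_m) (v : 'rV[Cplx]_n) : 'rV[Cplx]_(m * n) :=
  u *t v.

Definition QLS (n : nat) (Psi : 'I_n -> 'I_n -> 'rV[Cplx]_n) : Prop :=
  (forall i j, unit_vec (Psi i j)) /\
  (forall i, is_onb (fun j => Psi i j)) /\
  (forall j, is_onb (fun i => Psi i j)).

Definition orthogonal_QLS (n : nat) (Psi Phi : 'I_n -> 'I_n -> 'rV[Cplx]_n) : Prop :=
  is_onb (fun ij : 'I_n * 'I_n => ktens (Psi ij.1 ij.2) (Phi ij.1 ij.2)).

Definition latin_square (n : nat) (L : 'I_n -> 'I_n -> 'I_n) : Prop :=
  (forall i, bijective (fun j => L i j)) /\ (forall j, bijective (fun i => L i j)).

Definition classical_QLS (n : nat) (Psi : 'I_n -> 'I_n -> 'rV[Cplx]_n) : Prop :=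
  exists (e : 'I_n -> 'rV[Cplx]_n) (L : 'I_n -> 'I_n -> 'I_n),
    is_onb e /\ latin_square L /\
    (forall i j, exists c : Cplx, Psi i j = c *: e (L i j)).

(* Main.v *)
(* Call two cells overlapping in a square if their entries are not orthogonal.
   Orthogonality of the pair says that distinct cells never overlap in both
   squares, and expanding inner products in the basis given by a row restricts
   the overlap relations combinatorially. For two rows, say that a square is
   small on them if every entry of one row is supported on at most two entries
   of the other. A finite search over overlap patterns shows that one of the two
   squares is small on all pairs of rows. Such a square splits into blocks of
   dimension at most two, and in a block of dimension two the lines can be halved
   so that exactly one of any two orthogonal lines is chosen. Sending chosen lines
   to one basis vector and the others to the second gives a Latin square two of
   whose cells carry the same symbol only if they overlap; hence their entries in
   the other square are orthogonal, and the Latin square is orthogonal to it. *)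

From Stdlib Require Import BinNums BinPos BinNat FMapPositive.
From HB Require Import structures.
Require Import Defs.
From mathcomp Require Import all_boot all_algebra.
From mathcomp Require Import all_order mxtens zify ring.
Set Implicit Arguments. Unset Strict Implicit. Unset Printing Implicit Defensive.
Import Order.TTheory GRing.Theory Num.Theory.

Module PM := PositiveMap.

Lemma positive_eqP : Equality.axiom Pos.eqb.
Proof. by move=> p q; apply: (iffP idP) => /Pos.eqb_eq. Qed.

HB.instance Definition _ := hasDecEq.Build positive positive_eqP.

(** * A solver for finite constraint problems *)

(* A constraint is a disjunction of cubes, a cube a conjunction of literals,
   and the literal (b, p) says that the variable p has the value b. *)
Definition literal := (bool * positive)%type.
Definition cube := seq literal.
Definition constraint := seq cube.

Section Satisfaction.
Variable v : positive -> bool.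
Definition sat_literal (l : literal) := v l.2 == l.1.
Definition sat_cube (q : cube) := all sat_literal q.
Definition sat (c : constraint) := has sat_cube c.
Definition agrees (m : PM.t bool) := forall (p : positive) b, PM.find p m = Some b -> v p = b.
End Satisfaction.

Fixpoint reduce_cube (m : PM.t bool) (q : cube) : option cube :=
  if q is l :: q' then
    match PM.find l.2 m with
    | Some b => if b == l.1 then reduce_cube m q' else None
    | None => if reduce_cube m q' is Some r then Some (l :: r) else None
    end
  else Some [::].

(* The result None means that m already satisfies the constraint. *)
Fixpoint reduce (m : PM.t bool) (c : constraint) : option constraint :=
  if c is q :: c' then
    match reduce_cube m q with
    | Some [::] => None
    | Some r => if reduce m c' is Some s then Some (r :: s) else None
    | None => reduce m c'
    end
  else Some [::].

Definition assign (m : PM.t bool) (q : cube) :=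
  foldl (fun m (l : literal) => PM.add l.2 l.1 m) m q.

(* The result None means that a constraint has become false. *)
Fixpoint propagate (m : PM.t bool) (cs out : seq constraint) (changed : bool) :
    option (PM.t bool * seq constraint * bool) :=
  if cs is c :: cs' then
    match reduce m c with
    | None => propagate m cs' out changed
    | Some [::] => None
    | Some [:: q] => propagate (assign m q) cs' out true
    | Some r => propagate m cs' (r :: out) changed
    end
  else Some (m, out, changed).

(* The choice of the branching variable affects only the size of the search tree. *)
Definition tally (t : PM.t N) (w : N) (c : constraint) :=
  foldl (foldl (fun t (l : literal) =>
    PM.add l.2 (N.add w (odflt 0%num (PM.find l.2 t))) t)) t c.

Definition weights (cs : seq constraint) :=
  foldl (fun t c => match c with
    | [:: _; _] => tally t 4%num c
    | [:: _; _; _] => tally t 1%num c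
    | _ => t
    end) (PM.empty N) cs.

Definition branching_variable (cs : seq constraint) : positive :=
  (PM.fold (fun p n (best : positive * N) =>
     if N.ltb best.2 n then (p, n) else best) (weights cs) (xH, 0%num)).1.

(** Running out of fuel counts as failure, so only a positive answer carries information. A pass
    that assigns nothing leaves constraints free of the variables of [m], so both branches may
    restart from a map holding the branching variable alone. *)
Fixpoint refute (fuel : nat) (m : PM.t bool) (cs : seq constraint) : bool :=
  if fuel is fuel'.+1 then
    match propagate m cs [::] false with
    | None => true
    | Some (m', cs', true) => refute fuel' m' cs'
    | Some (_, cs', false) =>
        let p := branching_variable cs' in
        refute fuel' (PM.add p true (PM.empty bool)) cs' &&
        refute fuel' (PM.add p false (PM.empty bool)) cs'
    end
  else false.

(** * Soundness of refutation by propagation and branching *)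

Section Soundness.
Variable v : positive -> bool.

Lemma agrees_empty : agrees v (PM.empty bool).
Proof. by move=> p b; rewrite PM.gempty. Qed.

Lemma agrees_add m (p : positive) : agrees v m -> agrees v (PM.add p (v p) m).
Proof.
move=> vm p' b; case: (p' =P p) => [->|ne].
  by rewrite PM.gss => -[].
by rewrite PM.gso //; apply: vm.
Qed.

Lemma agrees_assign m q : agrees v m -> sat_cube v q -> agrees v (assign m q).
Proof.
elim: q m => //= l q IHq m vm /andP[/eqP vl vq].
by apply: IHq => //; rewrite -vl; apply: agrees_add.
Qed.

Lemma sat_reduce_cube m q : agrees v m -> sat_cube v q ->
  exists2 r, reduce_cube m q = Some r & sat_cube v r.
Proof.
move=> vm; elim: q => [|l q IHq] /=; first by exists [::].
case/andP=> vl /IHq[r -> vr].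
case: PM.find (vm l.2) => [b /(_ b erefl) vb|_]; last by exists (l :: r); rewrite //= vl.
by rewrite -vb; move/eqP: vl => ->; rewrite eqxx; exists r.
Qed.

Lemma sat_reduce m c r : agrees v m -> sat v c -> reduce m c = Some r -> sat v r.
Proof.
move=> vm; elim: c r => [|q c IHc] //= r /orP[vq|vc].
  have [s -> vs] := sat_reduce_cube vm vq.
  by case: s vs => // l s vs; case: reduce => // r' [<-]; apply/orP; left.
case: reduce_cube => [[|l s]|] //; last exact: IHc.
case: reduce IHc => // r' /(_ r' vc erefl) vr' [<-].
by apply/orP; right.
Qed.

(** A single remaining cube is forced, so [v] satisfies it and agrees with the enlarged assignment.
    An empty constraint cannot arise, since [v] satisfies every reduced constraint. *)
Lemma propagate_sound m cs out changed :
    agrees v m -> all (sat v) cs -> all (sat v) out ->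
  exists m' cs' changed', [/\ propagate m cs out changed = Some (m', cs', changed'),
    agrees v m' & all (sat v) cs'].
Proof.
elim: cs m out changed => [|c cs IHcs] m out changed vm /=.
  by exists m, out, changed.
case/andP=> vc vcs vout; case rc: reduce => [r|]; last exact: IHcs.
have := sat_reduce vm vc rc; case: r {rc} => [|q [|q' r]] //= vr.
  by apply: IHcs => //; apply: agrees_assign => //; rewrite orbF in vr.
by apply: IHcs => //=; rewrite vout andbT.
Qed.

(** The branch that gives the branching variable its value under [v] still agrees with [v], so by
    induction it is not refuted. *)
Lemma refute_sound fuel m cs : agrees v m -> all (sat v) cs -> ~~ refute fuel m cs.
Proof.
elim: fuel m cs => //= fuel IHfuel m cs vm vcs.
have [m' [cs' [[] [-> vm' vcs']]]] := propagate_sound (out := [::]) false vm vcs isT.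
  exact: IHfuel.
have := agrees_add (p := branching_variable cs') agrees_empty.
by rewrite negb_and; case: (v _) => vp; rewrite (IHfuel _ _ vp vcs') ?orbT.
Qed.

Lemma refuteP fuel cs : refute fuel (PM.empty bool) cs -> ~~ all (sat v) cs.
Proof. by apply: contraL => /(refute_sound fuel agrees_empty). Qed.

End Soundness.

(** * Overlap patterns *)

(* ov t x y says that the entries of square t at the cells x and y are not
   orthogonal. *)
Record pattern (ov : bool -> 'I_6 * 'I_6 -> 'I_6 * 'I_6 -> bool) : Prop := Pattern {
  ov_refl t x : ov t x x;
  ov_sym t x y : ov t x y = ov t y x;
  ov_line t x y : x != y -> (x.1 == y.1) || (x.2 == y.2) -> ~~ ov t x y;
  ov_disjoint x y : x != y -> ~~ (ov false x y && ov true x y);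
  ov_some t x y i : ov t x y -> exists c, ov t x (i, c) && ov t y (i, c);
  ov_many t x y i c : ~~ ov t x y -> ov t x (i, c) -> ov t y (i, c) ->
    exists2 d, d != c & ov t x (i, d) && ov t y (i, d);
  ov_hall t i k a b c d e : uniq [:: a; b; c] ->
    exists j f, [/\ j \in [:: a; b; c], f \notin [:: d; e] & ov t (i, j) (k, f)]
}.

(** * Encoding of overlap patterns as constraints *)

Definition position := (nat * nat)%type.

(** A coordinate below six takes three bits, lowest first, so that a valuation can recover the cells
    from a variable by repeated [pop]. *)
Definition push (n : nat) (p : positive) : positive :=
  match n with
  | 0 => xO (xO (xO p)) | 1 => xI (xO (xO p)) | 2 => xO (xI (xO p))
  | 3 => xI (xI (xO p)) | 4 => xO (xO (xI p)) | _ => xI (xO (xI p))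
  end.

Definition pop (p : positive) : nat * positive :=
  match p with
  | xO (xO (xO p)) => (0, p) | xI (xO (xO p)) => (1, p) | xO (xI (xO p)) => (2, p)
  | xI (xI (xO p)) => (3, p) | xO (xO (xI p)) => (4, p) | xI (xO (xI p)) => (5, p)
  | _ => (0, p)
  end.

Definition variable (t : bool) (a b : position) : positive :=
  push a.1 (push a.2 (push b.1 (push b.2 (if t then xI xH else xO xH)))).

(* Overlap is symmetric: each pair is stored once, smaller row first. *)
Definition overlap_literal (s t : bool) (a b : position) : literal :=
  (s, if a.1 < b.1 then variable t a b else variable t b a).

Definition same_line (a b : position) := (a.1 == b.1) || (a.2 == b.2).
Definition precedes (a b : position) := (a.1 < b.1) || (a.1 == b.1) && (a.2 < b.2).

Definition columns := iota 0 6.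
Definition other_columns j := [seq c <- columns | c != j].
Definition positions n : seq position := [seq (i, j) | i <- iota 0 n, j <- columns].

Definition disjoint_constraints n : seq constraint :=
  [seq [:: [:: overlap_literal false false ab.1 ab.2];
           [:: overlap_literal false true ab.1 ab.2]]
  | ab <- [seq (a, b) | a <- positions n, b <- positions n]
        & (ab.1.1 < ab.2.1) && (ab.1.2 != ab.2.2)].

(** The columns of [x] and [y] are left out: an entry outside row [r] is orthogonal to the entry of
    that row in its own column. *)
Definition common_positions (r : nat) (x y : position) : seq position :=
  [seq (r, c) | c <- columns & (c != x.2) && (c != y.2)].

Definition both_cube t x y c : cube :=
  [:: overlap_literal true t x c; overlap_literal true t y c].

Definition some_constraint t r (x y : position) : constraint :=
  [:: overlap_literal false t x y] :: [seq both_cube t x y c | c <- common_positions r x y].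

(** Clausal form of [ov_many]: a vanishing sum cannot have exactly one nonzero term. On a common
    line the entries at [x] and [y] are orthogonal anyway, so their overlap is not offered as an
    alternative. *)
Definition many_constraint t r (x y c : position) : constraint :=
  [:: overlap_literal false t x c] :: [:: overlap_literal false t y c] ::
  (if same_line x y then [::] else [:: [:: overlap_literal true t x y]]) ++
  [seq both_cube t x y d | d <- common_positions r x y & d != c].

Definition pair_constraints t r (x y : position) : seq constraint :=
  (if same_line x y then [::] else [:: some_constraint t r x y]) ++
  [seq many_constraint t r x y c | c <- common_positions r x y].

Definition support_constraint t r (x : position) : constraint :=
  [seq [:: overlap_literal true t x c] | c <- common_positions r x x].

Definition row_constraints t n r : seq constraint :=
  let out := [seq x <- positions n | x.1 != r] in
  [seq support_constraint t r x | x <- out] ++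
  flatten [seq pair_constraints t r xy.1 xy.2
  | xy <- [seq (x, y) | x <- out, y <- out] & precedes xy.1 xy.2].

Definition pattern_constraints n : seq constraint :=
  disjoint_constraints n ++
  flatten [seq row_constraints false n r ++ row_constraints true n r | r <- iota 0 n].

Definition triples (s : seq nat) : seq (nat * nat * nat) :=
  [seq abc <- [seq (ab, c) | ab <- [seq (a, b) | a <- s, b <- s], c <- s]
         | (abc.1.1 < abc.1.2) && (abc.1.2 < abc.2)].

Definition triple_seq (abc : nat * nat * nat) := [:: abc.1.1; abc.1.2; abc.2].

Definition small_constraints t i k : seq constraint :=
  flatten [seq [seq [seq [:: overlap_literal false t (i, j) (k, l)] | l <- triple_seq T]
               | T <- triples (other_columns j)] | j <- columns].

Definition large_constraint t i k j : constraint :=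
  [seq [seq overlap_literal true t (i, j) (k, l) | l <- triple_seq T]
  | T <- triples (other_columns j)].

Definition some_large_constraint t i k : constraint :=
  flatten [seq large_constraint t i k j | j <- columns].

Definition hall_constraints t i k : seq constraint :=
  [seq flatten [seq [seq [:: overlap_literal true t (i, j) (k, c)]
                    | c <- other_columns j & (c != de.1) && (c != de.2)]
               | j <- triple_seq T]
  | T <- triples columns, de <- [seq de <- [seq (d, e) | d <- columns, e <- columns]
                                       | de.1 < de.2]].

Definition exact_constraints t (x : position) r (s : seq nat) : seq constraint :=
  [seq [:: [:: overlap_literal (c \in s) t x (r, c)]] | c <- other_columns x.2].

(** Column 0 holds an entry of square [false] whose support contains columns 1, 2, 3; column [y]
    holds an entry of square [true] with at least three columns in its support. Renumbering columns
    reduces [y] to 0, to 1 (inside the chosen three) or to 4 (outside them). *)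
Definition two_row_constraints y : seq constraint :=
  [seq [:: [:: overlap_literal true false (0, 0) (1, j)]] | j <- [:: 1; 2; 3]] ++
  [:: large_constraint true 0 1 y] ++
  hall_constraints false 0 1 ++ hall_constraints true 0 1 ++ pattern_constraints 2.

(* Rows i, k, m, o of the lemmas below are numbered 0, 1, 2, 3; columns c, p, q, r, s
   are numbered 0, 1, 2, 3, 4, and the remaining column is 5. *)
Definition fork_constraints d e : seq constraint :=
  exact_constraints false (0, 1) 2 [:: 0; d] ++ exact_constraints false (0, 2) 2 [:: 0; d] ++
  exact_constraints false (1, 3) 2 [:: 0; e] ++ exact_constraints false (1, 4) 2 [:: 0; e].

(** The hypotheses of [three_rows_normal] with the negation of its conclusion. *)
Definition three_row_constraints d e : seq constraint :=
  fork_constraints d e ++ [:: some_large_constraint true 0 2] ++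
  small_constraints false 0 2 ++ small_constraints false 2 0 ++
  small_constraints false 1 2 ++ small_constraints false 2 1 ++
  small_constraints true 0 1 ++ small_constraints true 1 0 ++
  pattern_constraints 3.

Definition four_row_constraints d d' e e' : seq constraint :=
  fork_constraints d e ++ exact_constraints false (3, 5) 2 [:: 0] ++
  exact_constraints false (3, d') 2 [:: d] ++ exact_constraints false (3, e') 2 [:: e] ++
  [:: some_large_constraint true 2 3] ++ pattern_constraints 4.

(** The finite search, run by computation here and in the next two lemmas. The fuel 200 bounds the
    number of propagation passes along one branch. *)
Lemma two_row_refuted y : y \in [:: 0; 1; 4] ->
  refute 200 (PM.empty bool) (two_row_constraints y).
Proof. by rewrite !inE => /or3P[] /eqP->; vm_compute. Qed.

Lemma three_row_refuted de : de \in [:: (3, 1); (3, 5); (5, 1)] ->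
  refute 200 (PM.empty bool) (three_row_constraints de.1 de.2).
Proof. by rewrite !inE => /or3P[] /eqP->; vm_compute. Qed.

Lemma four_row_refuted dd ee :
    (dd, ee) \in [:: ((3, 4), (1, 2)); ((3, 4), (5, 1)); ((3, 4), (1, 0));
                     ((3, 4), (5, 0)); ((5, 3), (1, 0))] ->
  refute 200 (PM.empty bool) (four_row_constraints dd.1 dd.2 ee.1 ee.2).
Proof. by rewrite !inE => /or4P[||| /orP[]] /eqP[-> ->]; vm_compute. Qed.

Lemma popK n p : n < 6 -> pop (push n p) = (n, p).
Proof. by case: n => [|[|[|[|[|[|]]]]]]. Qed.

Lemma all_catI (T : Type) (P : pred T) (s1 s2 : seq T) :
  all P s1 -> all P s2 -> all P (s1 ++ s2).
Proof. by rewrite all_cat => -> ->. Qed.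

Lemma all_flatten (T : Type) (P : pred T) (ss : seq (seq T)) :
  all P (flatten ss) = all (all P) ss.
Proof. by elim: ss => //= s ss IHss; rewrite all_cat IHss. Qed.

(** The support of the entry at [x] when it is expanded in the orthonormal basis formed by row
    [k]. *)
Definition row_support (ov : bool -> 'I_6 * 'I_6 -> 'I_6 * 'I_6 -> bool) t x k : {set 'I_6} :=
  [set c | ov t x (k, c)].

(** * Overlap patterns satisfy the constraints *)

Section Validity.
Variables (ov : bool -> 'I_6 * 'I_6 -> 'I_6 * 'I_6 -> bool) (rows cols : seq 'I_6).
Hypotheses (ovP : pattern ov) (rows_uniq : uniq rows) (cols_uniq : uniq cols)
  (cols_size : size cols = 6).

(** Numbering the cells through freely chosen lists of rows and columns carries the symmetry
    reduction: a configuration is brought to normal form by choosing the lists. *)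
Definition cell_at (a : position) : 'I_6 * 'I_6 := (nth ord0 rows a.1, nth ord0 cols a.2).
Definition valid (a : position) := (a.1 < size rows) && (a.2 < 6).

Definition valuation (p : positive) : bool :=
  let: (i, p1) := pop p in let: (j, p2) := pop p1 in
  let: (k, p3) := pop p2 in let: (l, p4) := pop p3 in
  ov (if p4 is xI xH then true else false) (cell_at (i, j)) (cell_at (k, l)).

Local Notation o t a b := (ov t (cell_at a) (cell_at b)).

Lemma rows_size : size rows <= 6.
Proof. by have := max_card (mem rows); rewrite (card_uniqP rows_uniq) card_ord. Qed.

Lemma mem_cols c : c \in cols.
Proof.
have: cols =i predT by apply/(subset_cardP _ _); rewrite ?subset_predT // (card_uniqP cols_uniq) cols_size card_ord.
by move->.
Qed.

Lemma cols_nth c : exists2 l, l < 6 & nth ord0 cols l = c.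
Proof.
have := mem_cols c; rewrite -index_mem cols_size => lt6.
by exists (index c cols); rewrite ?nth_index ?mem_cols.
Qed.

Lemma valuation_variable t a b : valid a -> valid b -> valuation (variable t a b) = o t a b.
Proof.
case: a b => [i j] [k l] /andP[/= iV jV] /andP[/= kV lV].
have row6 n := fun lt_n => leq_trans (lt_n : n < size rows) rows_size.
by rewrite /valuation /variable /= popK ?row6 // popK // popK ?row6 // popK //; case: t.
Qed.

Lemma sat_overlap s t a b : valid a -> valid b ->
  sat_literal valuation (overlap_literal s t a b) = (o t a b == s).
Proof.
by move=> aV bV; rewrite /sat_literal /=; case: ifP; rewrite valuation_variable // (ov_sym ovP).
Qed.

Lemma cell_at_row a b : valid a -> valid b -> ((cell_at a).1 == (cell_at b).1) = (a.1 == b.1).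
Proof. by move=> /andP[aV _] /andP[bV _]; rewrite nth_uniq. Qed.

Lemma cell_at_col a b : valid a -> valid b -> ((cell_at a).2 == (cell_at b).2) = (a.2 == b.2).
Proof. by move=> /andP[_ aV] /andP[_ bV]; rewrite nth_uniq ?cols_size. Qed.

Lemma cell_at_eq a b : valid a -> valid b -> (cell_at a == cell_at b) = (a == b).
Proof. by move=> aV bV; rewrite -!pair_eqE /pair_eq cell_at_row // cell_at_col. Qed.

Lemma overlap_line t a b : valid a -> valid b -> a != b -> same_line a b -> o t a b = false.
Proof.
move=> aV bV ab line; apply/negbTE/(ov_line ovP); first by rewrite cell_at_eq.
by rewrite cell_at_row ?cell_at_col.
Qed.

Lemma overlap_column t x r c : valid x -> valid (r, c) -> x.1 != r -> o t x (r, c) -> c != x.2.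
Proof.
move=> xV cV xr; apply: contraTneq => cx; rewrite overlap_line //; last by rewrite /same_line cx eqxx orbT.
by apply: contraNneq xr => ->.
Qed.

Lemma mem_positions n a : n <= size rows -> a \in positions n -> valid a.
Proof.
move=> n_le /allpairsP[[i j] /= [+ + ->]]; rewrite !mem_iota /= => i_lt j_lt.
by rewrite /valid /= j_lt andbT (leq_trans i_lt).
Qed.

Lemma common_valid r x y c : r < size rows -> c \in common_positions r x y ->
  [/\ valid c, c.1 = r, c.2 != x.2 & c.2 != y.2].
Proof.
move=> rV /mapP[d]; rewrite mem_filter mem_iota => /andP[/andP[dx dy] d6] ->.
by split => //; apply/andP.
Qed.

Lemma common_positionsP t r x y c : valid x -> valid y -> r < size rows -> x.1 != r -> y.1 != r ->
  c < 6 -> o t x (r, c) -> o t y (r, c) -> (r, c) \in common_positions r x y.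
Proof.
move=> xV yV rV xr yr c6 xc yc; apply/map_f; rewrite mem_filter mem_iota /= c6 andbT.
have cV : valid (r, c) by rewrite /valid rV.
by rewrite (overlap_column xV cV xr xc) (overlap_column yV cV yr yc).
Qed.

Lemma sat_both t x y c : valid x -> valid y -> valid c ->
  sat_cube valuation (both_cube t x y c) = o t x c && o t y c.
Proof. by move=> xV yV cV; rewrite /= !sat_overlap // !eqb_id andbT. Qed.

Lemma sat_pair t r x y : valid x -> valid y -> r < size rows -> x.1 != r -> y.1 != r -> x != y ->
  all (sat valuation) (pair_constraints t r x y).
Proof.
move=> xV yV rV xr yr xy; rewrite /pair_constraints all_cat; apply/andP; split.
  case: ifP => //= line; rewrite andbT /sat /= sat_overlap // andbT.
  have [xoy|//] := boolP (o t x y).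
  have [c] := ov_some ovP (nth ord0 rows r) xoy; have [l l6 <-] := cols_nth c.
  case/andP=> xl yl; apply/orP; right; apply/hasP; exists (both_cube t x y (r, l)).
    exact/map_f/(common_positionsP xV yV rV xr yr l6 xl yl).
  by rewrite sat_both ?xl // /valid rV.
apply/allP=> _ /mapP[c cC ->]; have [cV cr cx cy] := common_valid rV cC.
rewrite /sat /= !sat_overlap // !andbT has_cat.
have [xc|//] := boolP (o t x c); have [yc|//] := boolP (o t y c).
(* If [x] and [y] overlap they are on no common line, so the literal for their overlap is present;
   otherwise [ov_many] supplies a second common column. *)
do 2!(apply/orP; right); have [xoy|xoy] := boolP (o t x y).
  case: ifP => [line|_]; first by rewrite overlap_line in xoy.
  by rewrite /= sat_overlap ?xoy.
case: c => [r' c] /= in cC cV cr cx cy xc yc *; rewrite {r'}cr in cC cV xc yc *.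
have [d dc] := ov_many ovP xoy xc yc; have [l l6 dE] := cols_nth d.
rewrite -dE => /andP[xl yl]; apply/orP; right; apply/hasP; exists (both_cube t x y (r, l)).
  apply/map_f; rewrite mem_filter (common_positionsP xV yV rV xr yr l6 xl yl) andbT.
  by apply: contraNneq dc => -[<-]; rewrite -dE.
by rewrite sat_both ?xl // /valid rV.
Qed.

Lemma sat_support t r x : valid x -> r < size rows -> x.1 != r ->
  sat valuation (support_constraint t r x).
Proof.
move=> xV rV xr; have [c] := ov_some ovP (nth ord0 rows r) (ov_refl ovP t (cell_at x)).
have [l l6 <-] := cols_nth c; case/andP=> xl _.
apply/hasP; exists [:: overlap_literal true t x (r, l)].
  exact: (map_f _ (common_positionsP xV xV rV xr xr l6 xl xl)).
by rewrite /= sat_overlap ?xl // /valid rV.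
Qed.

Lemma sat_row t n r : n <= size rows -> r < n -> all (sat valuation) (row_constraints t n r).
Proof.
move=> n_le rn; have rV := leq_trans rn n_le.
have outP x : x \in [seq x <- positions n | x.1 != r] -> valid x /\ x.1 != r.
  by rewrite mem_filter => /andP[xr /(mem_positions n_le)].
rewrite /row_constraints all_cat; apply/andP; split.
  by apply/allP=> _ /mapP[x /outP[xV xr] ->]; apply: sat_support.
rewrite all_flatten; apply/allP=> cs /mapP[xy]; rewrite mem_filter => /andP[xyp].
case/allpairsP=> -[x y] /= [/outP[xV xr] /outP[yV yr] xyE] ->.
rewrite {xy}xyE /= in xyp *; apply: sat_pair => //.
by apply: contraTneq xyp => ->; rewrite /precedes !ltnn eqxx.
Qed.

Lemma sat_pattern n : n <= size rows -> all (sat valuation) (pattern_constraints n).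
Proof.
move=> n_le; rewrite /pattern_constraints all_cat; apply/andP; split.
  apply/allP=> cs /mapP[ab]; rewrite mem_filter => /andP[abp].
  case/allpairsP=> -[a b] /= [/(mem_positions n_le) aV /(mem_positions n_le) bV abE] ->.
  rewrite abE /= in abp *; rewrite /sat /= !sat_overlap // !andbT !orbF !eqbF_neg -negb_and.
  apply: (ov_disjoint ovP); rewrite cell_at_eq //.
  by apply: contraTneq abp => ->; rewrite ltnn.
rewrite all_flatten; apply/allP=> _ /mapP[r + ->]; rewrite mem_iota => /= rn.
by rewrite all_cat !sat_row.
Qed.

Lemma mem_triples s T : T \in triples s ->
  {subset triple_seq T <= s} /\ uniq (triple_seq T).
Proof.
rewrite mem_filter => /andP[/andP[ab bc]] /allpairsP[[[a b] c] /= [/allpairsP[[a' b'] /= [a's b's [-> ->]]] cs TE]].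
move: ab bc; rewrite TE /= => ab bc; split => /=.
  by move=> x; rewrite !inE => /or3P[] /eqP->.
by rewrite !inE !negb_or (ltn_eqF ab) (ltn_eqF bc) (ltn_eqF (ltn_trans ab bc)).
Qed.

Lemma triples_f s a b c : a \in s -> b \in s -> c \in s -> a < b -> b < c ->
  (a, b, c) \in triples s.
Proof.
move=> aS bS cS ab bc; rewrite mem_filter /= ab bc /=.
by apply/allpairs_f => //; apply/allpairs_f.
Qed.

Lemma sat_hall t i k : i < size rows -> k < size rows -> i != k ->
  all (sat valuation) (hall_constraints t i k).
Proof.
move=> iV kV ik; apply/allP=> _ /allpairsP[[T [d e]] [TT _ ->]].
have [Tsub Tuniq] := mem_triples (T := T) TT.
have T6 x : x \in triple_seq T -> x < 6 by move/Tsub; rewrite mem_iota.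
have nthT : uniq [seq nth ord0 cols x | x <- triple_seq T].
  rewrite map_inj_in_uniq // => x y /T6 x6 /T6 y6 /eqP.
  by rewrite nth_uniq ?cols_size // => /eqP.
have [j [f [jT fde ijf]]] := ov_hall ovP t (nth ord0 rows i) (nth ord0 rows k)
   (nth ord0 cols d) (nth ord0 cols e) nthT.
have /mapP[x xT jE] : j \in [seq nth ord0 cols x | x <- triple_seq T] by [].
have [l l6 fE] := cols_nth f.
have xV : valid (i, x) by rewrite /valid iV T6.
have lV : valid (k, l) by rewrite /valid kV.
rewrite jE -fE in ijf; apply/hasP; exists [:: overlap_literal true t (i, x) (k, l)]; last first.
  by rewrite /= sat_overlap // /cell_at ijf.
apply/flattenP; eexists; first by apply/map_f; exact: xT.
apply/mapP; exists l => //; rewrite !mem_filter mem_iota /= l6 (overlap_column xV lV ik ijf) !andbT.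
move: fde; rewrite -fE !inE negb_or => /andP[fd fe].
by rewrite (contraNneq _ fd) ?(contraNneq _ fe) // => ->.
Qed.

Lemma sat_exact t x r (s : seq nat) : valid x -> r < size rows ->
    all (gtn 6) s ->
    row_support ov t (cell_at x) (nth ord0 rows r) =i [seq nth ord0 cols a | a <- s] ->
  all (sat valuation) (exact_constraints t x r s).
Proof.
move=> xV rV /allP s6 os; apply/allP=> _ /mapP[c + ->].
rewrite mem_filter mem_iota => /= /andP[_ c6].
have cV : valid (r, c) by rewrite /valid rV.
rewrite /sat /= !andbT orbF sat_overlap //; apply/eqP.
transitivity (nth ord0 cols c \in row_support ov t (cell_at x) (nth ord0 rows r)); first by rewrite inE.
rewrite os; apply/mapP/idP => [[a aS /eqP]|cS]; last by exists c.
by rewrite nth_uniq ?cols_size // => [/eqP->//|]; apply: (s6 a aS).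
Qed.

Lemma sat_small t i k : i < size rows -> k < size rows ->
    (forall j, #|row_support ov t (nth ord0 rows i, j) (nth ord0 rows k)| <= 2) ->
  all (sat valuation) (small_constraints t i k).
Proof.
move=> iV kV small; rewrite all_flatten; apply/allP=> _ /mapP[j + ->].
rewrite mem_iota => /andP[_ j6]; apply/allP=> _ /mapP[T /mem_triples[Tsub Tuniq] ->].
have T6 x : x \in triple_seq T -> x < 6.
  by move/Tsub; rewrite mem_filter mem_iota => /andP[].
have jV : valid (i, j) by rewrite /valid iV.
rewrite [sat _ _]has_map; apply: contraLR (small (nth ord0 cols j)) => /hasPn none.
rewrite -ltnNge; apply/card_geqP; exists [seq nth ord0 cols x | x <- triple_seq T]; split => //.
  rewrite map_inj_in_uniq // => x y /T6 x6 /T6 y6 /eqP.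
  by rewrite nth_uniq ?cols_size // => /eqP.
move=> _ /mapP[l lT ->]; have := none _ lT.
rewrite /= andbT sat_overlap //; last by rewrite /valid kV T6.
by rewrite eqbF_neg negbK inE.
Qed.

Lemma sat_large t i k j : i < size rows -> k < size rows -> i != k -> j < 6 ->
    2 < #|row_support ov t (cell_at (i, j)) (nth ord0 rows k)| ->
  sat valuation (large_constraint t i k j).
Proof.
move=> iV kV ik j6; have jV : valid (i, j) by rewrite /valid iV.
set A := row_support _ _ _ _ => large.
pose s := [seq l <- columns | nth ord0 cols l \in A].
have sP l : l \in s -> [/\ l < 6, l != j & o t (i, j) (k, l)].
  rewrite mem_filter mem_iota inE => /andP[jl /= l6]; split => //.
  have lV : valid (k, l) by rewrite /valid kV.
  exact: (overlap_column jV lV ik jl).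
have: 2 < size s.
  rewrite size_filter -(count_map _ (mem A)) map_nth_iota0 ?cols_size // take_oversize ?cols_size //.
  rewrite -size_filter (leq_trans large) // cardE uniq_leq_size ?enum_uniq //.
  by move=> c; rewrite mem_enum mem_filter mem_cols andbT.
(* Sortedness puts the first three columns of the support in increasing order, the form in which
   [triples] lists them. *)
have: sorted ltn s by apply: sorted_filter (iota_ltn_sorted _ _); apply: ltn_trans.
case: (s) sP => [|a [|b [|c s']]] // sP /= /and3P[ab bc _] _.
have in_s x : x \in [:: a; b; c] -> [/\ x < 6, x != j & o t (i, j) (k, x)].
  by move=> xs; apply: sP; rewrite -[_ :: _]/([:: a; b; c] ++ s') mem_cat xs.
apply/hasP; exists [seq overlap_literal true t (i, j) (k, l) | l <- [:: a; b; c]].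
  apply: (map_f (fun T => [seq overlap_literal true t (i, j) (k, l) | l <- triple_seq T]) (x := (a, b, c))).
  apply: triples_f => //; rewrite mem_filter mem_iota /=;
    by [have [-> ->] := in_s a (mem_head _ _)
      | have [|-> ->] := in_s b; rewrite ?inE ?eqxx ?orbT
      | have [|-> ->] := in_s c; rewrite ?inE ?eqxx ?orbT].
rewrite /sat_cube all_map; apply/allP=> x /in_s[x6 _ jx].
by rewrite /= sat_overlap ?jx // /valid kV.
Qed.

Lemma sat_some_large t i k j : i < size rows -> k < size rows -> i != k ->
    2 < #|row_support ov t (nth ord0 rows i, j) (nth ord0 rows k)| ->
  sat valuation (some_large_constraint t i k).
Proof.
move=> iV kV ik; have [l l6 <-] := cols_nth j => large.
have /hasP[q qL vq] := sat_large iV kV ik l6 large.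
apply/hasP; exists q => //; apply/flattenP; exists (large_constraint t i k l) => //.
by apply/map_f; rewrite mem_iota.
Qed.

End Validity.

(** * Rows with small supports *)

Section Combinatorics.
Variable ov : bool -> 'I_6 * 'I_6 -> 'I_6 * 'I_6 -> bool.
Hypothesis ovP : pattern ov.

Local Notation S t x k := (row_support ov t x k).

Definition small t i k := [forall j, #|S t (i, j) k| <= 2].

Lemma mem_support t x k c : (c \in S t x k) = ov t x (k, c).
Proof. by rewrite inE. Qed.

Lemma support_sym t i j k c : (c \in S t (i, j) k) = (j \in S t (k, c) i).
Proof. by rewrite !mem_support (ov_sym ovP). Qed.

Lemma smallPn t i k : ~~ small t i k -> exists j, 2 < #|S t (i, j) k|.
Proof. by move/forallPn=> [j]; rewrite -ltnNge; exists j. Qed.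

Lemma small_support t i k j : small t i k -> #|S t (i, j) k| <= 2.
Proof. by move/forallP. Qed.

Lemma row_orthogonal t i a b : a != b -> ~~ ov t (i, a) (i, b).
Proof.
move=> ab; apply: (ov_line ovP); last by rewrite eqxx.
by apply: contraNneq ab => -[->].
Qed.

Lemma overlap_columns t i k a b : i != k -> ov t (i, a) (k, b) -> a != b.
Proof.
move=> ik; apply: contraTneq => ->; apply: (ov_line ovP); last by rewrite /= eqxx orbT.
by apply: contraNneq ik => -[->].
Qed.

Lemma support_neq0 t x k : exists c, c \in S t x k.
Proof.
have [c /andP[xc _]] := ov_some ovP k (ov_refl ovP t x).
by exists c; rewrite inE.
Qed.

Lemma overlap_common t x y k : ov t x y -> exists2 c, c \in S t x k & c \in S t y k.
Proof. by move/(ov_some ovP k) => [c /andP[xc yc]]; exists c; rewrite inE. Qed.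

Lemma orthogonal_common t x y k c : ~~ ov t x y -> c \in S t x k -> c \in S t y k ->
  exists2 d, d != c & (d \in S t x k) && (d \in S t y k).
Proof.
rewrite !inE => xy xc yc; have [d dc] := ov_many ovP xy xc yc.
by exists d; rewrite // !inE.
Qed.

(** An inner product whose expansion along row [k] has exactly one nonzero term is nonzero. *)
Lemma single_common t x y k c : c \in S t x k -> c \in S t y k ->
  (forall d, d \in S t x k -> d \in S t y k -> d = c) -> ov t x y.
Proof.
move=> xc yc only_c; have [//|xy] := boolP (ov t x y).
have [d dc /andP[xd yd]] := orthogonal_common xy xc yc.
by rewrite (only_c d) ?eqxx in dc.
Qed.

(** Three orthonormal vectors do not fit in the span of two. *)
Lemma three_in_pair t i k a b c d e : uniq [:: a; b; c] ->
  ~ (forall j, j \in [:: a; b; c] -> S t (i, j) k \subset [set d; e]).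
Proof.
move=> abc sub; have [j [f [/sub/subsetP jsub + jf]]] := ov_hall ovP t i k d e abc.
by move: (jsub f); rewrite !inE => /(_ jf) ->.
Qed.

Lemma eq_pair (A : {set 'I_6}) c d : #|A| <= 2 -> c \in A -> d \in A -> c != d -> A = [set c; d].
Proof.
move=> A2 cA dA cd; apply/esym/eqP; rewrite eqEcard cards2 cd A2 andbT.
by apply/subsetP=> x; rewrite !inE => /orP[] /eqP->.
Qed.

(** If three entries of row [i] overlap the entry at [(k, c)], then by orthogonality the first
    shares a further column with each of the others. Its support has at most two elements, so this
    column is the same [d], and all three supports equal [[set c; d]]. *)
Lemma small_sym t i k : small t i k -> small t k i.
Proof.
move=> ik; apply/forallP=> c; rewrite leqNgt; apply/negP => /card_geqP[s [+ + sub]].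
case: s sub => [|x [|y [|w []]]] // sub xyw _.
have Sc z : z \in [:: x; y; w] -> c \in S t (i, z) k.
  by move=> /sub; rewrite support_sym.
have [xy xw] : x != y /\ x != w by move: xyw; rewrite /= !inE negb_or => /andP[/andP[]].
have Sx := Sc x (mem_head _ _).
have Sy : c \in S t (i, y) k by apply: Sc; rewrite !inE eqxx orbT.
have Sw : c \in S t (i, w) k by apply: Sc; rewrite !inE eqxx !orbT.
have [d dc /andP[xd yd]] := orthogonal_common (row_orthogonal t i xy) Sx Sy.
have [d' d'c /andP[xd' wd']] := orthogonal_common (row_orthogonal t i xw) Sx Sw.
have Exd := eq_pair (small_support x ik) Sx xd; rewrite eq_sym in Exd.
have d'd : d' = d.
  by move: xd'; rewrite Exd // !inE (negbTE d'c) => /eqP.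
rewrite d'd in wd'; apply: (@three_in_pair t i k x y w c d xyw) => j.
rewrite !inE => /or3P[] /eqP->; rewrite subEproper; apply/orP; left; apply/eqP;
  by apply: eq_pair => //; rewrite ?small_support // eq_sym.
Qed.

(** The entries at [(k, c)] and [(k, d)] are orthogonal and both overlap [(i, a)], so they overlap a
    second entry of row [i] in common. *)
Lemma companion t i k a c d : small t i k -> S t (i, a) k = [set c; d] -> c != d ->
  exists2 b, b != a & S t (i, b) k = [set c; d].
Proof.
move=> ik Sa cd.
have ac : a \in S t (k, c) i by rewrite -support_sym Sa !inE eqxx.
have ad : a \in S t (k, d) i by rewrite -support_sym Sa !inE eqxx orbT.
have [b ba /andP[bc bd]] := orthogonal_common (row_orthogonal t k cd) ac ad.
by exists b => //; apply: eq_pair => //; rewrite ?small_support // support_sym.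
Qed.

(* The entries at (m, c) and (m, d), respectively (m, c) and (m, e), span a block of
   dimension two shared by rows i and m, respectively k and m. *)
Definition fork t i k m p q r s c d e :=
  [/\ uniq [:: c; d; e],
      p != q /\ r != s,
      S t (i, p) m = [set c; d] /\ S t (i, q) m = [set c; d] &
      S t (k, r) m = [set c; e] /\ S t (k, s) m = [set c; e]].

(** An entry of row [i] overlapping three entries of row [k] meets the support of each of them in
    row [m]. The three do not fit in the span of its own support, so one support leaves it;
    companions then complete both blocks. *)
Lemma fork_exists t i k m : small t i m -> small t k m -> ~~ small t i k ->
  exists p q r s c d e, fork t i k m p q r s c d e.
Proof.
move=> im km /smallPn[a /card_geqP[bs [+ + sub]]].
case: bs sub => [|b1 [|b2 [|b3 []]]] // sub bs _.
have meet b : b \in [:: b1; b2; b3] ->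
    exists2 x, x \in S t (i, a) m & x \in S t (k, b) m.
  by move=> /sub; rewrite mem_support => /overlap_common; apply.
have [x0 x0a] := support_neq0 t (i, a) m.
have [y Sa] : exists y, S t (i, a) m = [set x0; y].
  have [/cards1P[x Sx]|a1] := boolP (#|S t (i, a) m| == 1).
    by exists x0; rewrite setUid Sx; move: x0a; rewrite Sx => /set1P->.
  have : 1 < #|S t (i, a) m|.
    by rewrite ltn_neqAle eq_sym a1 card_gt0; apply/set0Pn; exists x0.
  case/card_gt1P => u [w [ua wa uw]].
  have [xu|xu] := eqVneq x0 u.
    by exists w; apply: eq_pair; rewrite ?small_support // xu.
  by exists u; apply: eq_pair; rewrite ?small_support.
have [b bB bsub] : exists2 b, b \in [:: b1; b2; b3] & ~~ (S t (k, b) m \subset [set x0; y]).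
  apply/hasP; rewrite -[has _ _]negbK -all_predC; apply/negP => /allP all_sub.
  by apply: (@three_in_pair t k m b1 b2 b3 x0 y bs) => j /all_sub /=; rewrite negbK.
have [c ca cb] := meet b bB.
have {bsub} [e eb ea] : exists2 e, e \in S t (k, b) m & e \notin S t (i, a) m.
  by rewrite Sa; case/subsetPn: bsub => e; exists e.
have ce : c != e by apply: contraNneq ea => <-.
have Sb : S t (k, b) m = [set c; e] by apply: eq_pair; rewrite ?small_support.
have [d dc Sa'] : exists2 d, c != d & S t (i, a) m = [set c; d].
  have [xy|xy] := eqVneq x0 y; last first.
    rewrite Sa in ca *; case/set2P: ca => ->; first by exists y.
    by exists x0; rewrite 1?eq_sym // setUC.
  move: Sa; rewrite xy setUid => Sa.
  (* Orthogonal cells whose supports contain c share a second element. *)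
  exfalso; have cy : c = y by apply/set1P; rewrite -Sa.
  have cB b' : b' \in [:: b1; b2; b3] -> c \in S t (k, b') m.
    by move=> /meet[z]; rewrite Sa cy => /set1P->.
  apply: (@three_in_pair t k m b1 b2 b3 c e bs) => b' b'B.
  have [->|bb'] := eqVneq b' b; first by rewrite Sb.
  have [f fc /andP[fb' fb]] := orthogonal_common (row_orthogonal t k bb') (cB _ b'B) cb.
  move: fb; rewrite Sb !inE (negbTE fc) /= => /eqP fe.
  suff -> : S t (k, b') m = [set c; e] by apply: subxx.
  by apply: eq_pair; rewrite ?small_support ?cB // -fe.
have [q qa Sq] := companion im Sa' dc; have [s sb Ss] := companion km Sb ce.
exists a, q, b, s, c, d, e; split => //; last by split; rewrite eq_sym.
rewrite /= !inE negb_or dc ce /= andbT; apply: contraNneq ea => <-.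
by rewrite Sa' !inE eqxx orbT.
Qed.

Lemma fork_swap t i k m p q r s c d e :
  fork t i k m p q r s c d e -> fork t k i m r s p q c e d.
Proof.
case=> /= cde [pq rs] [Sp Sq] [Sr Ss]; split => //; move: cde.
by rewrite /= !inE !negb_or [e == d]eq_sym => /and3P[/andP[-> ->] -> _].
Qed.

Lemma fork_swapl t i k m p q r s c d e :
  fork t i k m p q r s c d e -> fork t i k m q p r s c d e.
Proof. by case=> cde [pq rs] [Sp Sq] Srs; split => //; rewrite eq_sym. Qed.

Lemma fork_swapr t i k m p q r s c d e :
  fork t i k m p q r s c d e -> fork t i k m p q s r c d e.
Proof. by case=> cde [pq rs] Spq [Sr Ss]; split => //; rewrite [_ == r]eq_sym. Qed.

(** Overlapping entries of different rows are in different columns. The supports of [p] or [q] and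
    of [r] or [s] share only [c], so these entries overlap. *)
Lemma fork_columns t i k m p q r s c d e : i != k -> i != m -> k != m ->
  fork t i k m p q r s c d e -> uniq [:: c; p; q; r; s] /\ d \notin [:: c; p; q].
Proof.
move=> ik im km [cde [pq rs] [Sp Sq] [Sr Ss]].
have [cd ce de] : [/\ c != d, c != e & d != e].
  by move: cde; rewrite /= !inE negb_or => /andP[/andP[? ?] /andP[? _]].
have neq l x y : l != m -> S t (l, x) m = [set c; y] -> c != x.
  move=> lm Sx; rewrite eq_sym; apply: (overlap_columns (t := t) lm).
  by rewrite -mem_support Sx !inE eqxx.
have neq' x y : S t (i, x) m = [set c; d] -> S t (k, y) m = [set c; e] -> x != y.
  move=> Sx Sy; apply: (overlap_columns (t := t) ik).
  apply: (single_common (k := m) (c := c)); rewrite ?Sx ?Sy ?inE ?eqxx // => z.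
  rewrite !inE => /orP[/eqP->//|/eqP->]; rewrite [d == c]eq_sym (negbTE cd).
  by rewrite (negbTE de).
split.
  rewrite /= !inE !negb_or pq rs (neq _ _ _ im Sp) (neq _ _ _ im Sq) (neq _ _ _ km Sr).
  by rewrite (neq _ _ _ km Ss) (neq' _ _ Sp Sr) (neq' _ _ Sp Ss) (neq' _ _ Sq Sr) (neq' _ _ Sq Ss).
have neqd x : S t (i, x) m = [set c; d] -> d != x.
  move=> Sx; rewrite eq_sym; apply: (overlap_columns (t := t) im).
  by rewrite -mem_support Sx !inE eqxx orbT.
by rewrite !inE !negb_or eq_sym cd !neqd.
Qed.

(* Otherwise the entry at (k, b) would be in the span of the entries at (i, a) and
   its companion, which is the span of the entries at (m, c) and (m, d). *)
Lemma pairs_agree t i k m a b c d e : small t i k -> small t i m -> small t k m ->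
    S t (i, a) m = [set c; d] -> S t (k, b) m = [set c; e] -> c != d -> c != e -> d = e.
Proof.
move=> ik im km Sa Sb cd ce; apply: contraTeq isT => de.
have [a' a'a Sa'] := companion im Sa cd.
have ov_ab x : S t (i, x) m = [set c; d] -> x \in S t (k, b) i.
  move=> Sx; rewrite mem_support (ov_sym ovP).
  apply: (single_common (k := m) (c := c)); rewrite ?Sx ?Sb ?inE ?eqxx // => z.
  rewrite !inE => /orP[/eqP->//|/eqP->]; rewrite [d == c]eq_sym (negbTE cd).
  by rewrite (negbTE de).
have Sbi : S t (k, b) i = [set a; a'].
  by apply: eq_pair; rewrite ?ov_ab // 1?eq_sym //; apply/small_support/small_sym.
have : ov t (m, e) (k, b) by rewrite (ov_sym ovP) -mem_support Sb !inE eqxx orbT.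
case/(overlap_common i)=> u; rewrite -support_sym Sbi => eu /set2P uE; exfalso.
have Su : S t (i, u) m = [set c; d] by case: uE => ->.
by move: eu; rewrite Su !inE eq_sym (negbTE ce) eq_sym (negbTE de).
Qed.

Lemma extend_columns (s : seq 'I_6) : uniq s ->
  exists s', uniq (s ++ s') /\ size (s ++ s') = 6.
Proof.
move=> sU; exists [seq c <- enum 'I_6 | c \notin s]; split.
  rewrite cat_uniq sU filter_uniq ?enum_uniq // andbT; apply/hasPn=> c.
  by rewrite mem_filter => /andP[].
rewrite size_cat size_filter -[RHS](card_ord 6) -(cardC (mem s)) (card_uniqP sU); congr (_ + _).
by rewrite -size_filter cardE /enum_mem -filter_predI; congr size; apply: eq_filter => c; rewrite !inE andbT.
Qed.

Lemma two_rows i k : i != k -> small false i k || small true i k.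
Proof.
move=> ik; apply: contraTT isT; rewrite negb_or => /andP[/smallPn[x xlarge] /smallPn[y ylarge]].
have [s [sx xs sub]] : exists s, [/\ size s = 3, uniq (x :: s) & {subset s <= S false (i, x) k}].
  case/card_geqP: xlarge => s [sU ss sub]; exists s; split => //=.
  rewrite sU andbT; apply: contraT; rewrite negbK => /sub.
  by rewrite mem_support => /(overlap_columns ik); rewrite eqxx.
have [l [cols [colsU colsS subl [lP lE]]]] : exists l cols, [/\ uniq cols, size cols = 6,
    {subset [:: nth ord0 cols 1; nth ord0 cols 2; nth ord0 cols 3] <= S false (i, nth ord0 cols 0) k} &
    l \in [:: 0; 1; 4] /\ nth ord0 cols l = y].
  case: s sx xs sub => [|a [|b [|c []]]] // _ xs sub.
  (* The columns are listed with [x] first and three columns of its support next. The column [y]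
     then has index 0 if it is [x], index 4 if it is outside these four, and is moved to index 1
     otherwise. *)
  have [xy|xy] := eqVneq x y.
    have [s' [U Z]] := extend_columns xs.
    by exists 0, ([:: x; a; b; c] ++ s'); split.
  have [ys|ys] := boolP (y \in [:: a; b; c]); last first.
    have [|s' [U Z]] := @extend_columns [:: x; a; b; c; y].
      by rewrite -[[:: _; _; _; _; _]]/(rcons [:: x; a; b; c] y) rcons_uniq xs andbT inE eq_sym negb_or xy.
    by exists 4, ([:: x; a; b; c; y] ++ s'); split.
  have perm : perm_eq [:: a; b; c] (y :: rem y [:: a; b; c]) by apply: perm_to_rem.
  have : size (rem y [:: a; b; c]) = 2 by rewrite size_rem.
  case E: (rem y [:: a; b; c]) perm => [|b' [|c' []]] // perm _.
  have [|s' [U Z]] := @extend_columns [:: x; y; b'; c'].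
    move: xs; rewrite -[[:: x; a; b; c]]cat1s -[[:: x; y; _; _]]cat1s.
    by rewrite (@perm_uniq _ _ ([:: x] ++ [:: y; b'; c'])) // perm_cat2l.
  exists 1, ([:: x; y; b'; c'] ++ s'); split => // z.
  by rewrite -(perm_mem perm); apply: sub.
have rowsU : uniq [:: i; k] by rewrite /= inE ik.
have l6 : l < 6 by move: lP; rewrite !inE => /or3P[] /eqP->.
have /negP[] := refuteP (valuation ov [:: i; k] cols) (two_row_refuted lP).
apply: all_catI.
  apply/allP=> _ /mapP[a aP ->]; have a6 : a < 6 by move: aP; rewrite !inE => /or3P[] /eqP->.
  rewrite /sat /= orbF andbT sat_overlap //.
  have: nth ord0 cols a \in S false (i, nth ord0 cols 0) k.
    by apply: subl; move: aP; rewrite !inE => /or3P[] /eqP->; rewrite eqxx ?orbT.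
  by rewrite mem_support eqb_id.
apply: all_catI.
  by rewrite all_seq1; apply: sat_large => //; rewrite /cell_at /= lE.
apply: all_catI; first exact: sat_hall.
apply: all_catI; first exact: sat_hall.
exact: sat_pattern.
Qed.

End Combinatorics.

(** * Forks over three and four rows *)

Section ForkExclusion.
Variable ov : bool -> 'I_6 * 'I_6 -> 'I_6 * 'I_6 -> bool.
Hypothesis ovP : pattern ov.

Local Notation S t x k := (row_support ov t x k).
Local Notation small := (small ov).
Local Notation fork := (fork ov).

Lemma all_columns (c p q r s n : 'I_6) : uniq [:: c; p; q; r; s; n] ->
  forall x, x \in [:: c; p; q; r; s; n].
Proof. by move=> U; apply: mem_cols. Qed.

Lemma sat_fork rows i k m p q r s n c d e d6 e6 :
    uniq [:: i, k, m & rows] -> uniq [:: c; p; q; r; s; n] ->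
    fork false i k m p q r s c d e ->
    d6 < 6 -> e6 < 6 -> nth ord0 [:: c; p; q; r; s; n] d6 = d ->
    nth ord0 [:: c; p; q; r; s; n] e6 = e ->
  all (sat (valuation ov [:: i, k, m & rows] [:: c; p; q; r; s; n])) (fork_constraints d6 e6).
Proof.
move=> rowsU colsU [_ _ [Sp Sq] [Sr Ss]] d6P e6P dE eE.
apply: all_catI.
  by apply: sat_exact => //=; rewrite ?d6P // => z; rewrite Sp !inE dE.
apply: all_catI.
  by apply: sat_exact => //=; rewrite ?d6P // => z; rewrite Sq !inE dE.
apply: all_catI.
  by apply: sat_exact => //=; rewrite ?e6P // => z; rewrite Sr !inE eE.
by apply: sat_exact => //=; rewrite ?e6P // => z; rewrite Ss !inE eE.
Qed.

Lemma sat_smalls rows cols t i k : uniq rows -> uniq cols -> size cols = 6 ->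
    i < size rows -> k < size rows -> small t (nth ord0 rows i) (nth ord0 rows k) ->
  all (sat (valuation ov rows cols)) (small_constraints t i k ++ small_constraints t k i).
Proof.
move=> rowsU colsU colsS iV kV ik; apply: all_catI; apply: sat_small => // j.
  exact: small_support.
exact/small_support/small_sym.
Qed.

Lemma three_rows_normal i k m p q r s n c d e d6 e6 :
    uniq [:: i; k; m] -> uniq [:: c; p; q; r; s; n] -> fork false i k m p q r s c d e ->
    (d6, e6) \in [:: (3, 1); (3, 5); (5, 1)] ->
    nth ord0 [:: c; p; q; r; s; n] d6 = d -> nth ord0 [:: c; p; q; r; s; n] e6 = e ->
    small false i m -> small false k m -> small true i k ->
  small true i m.
Proof.
move=> rowsU colsU F de dE eE im km ik; apply: contraT => /smallPn[j large].
have [d6P e6P] : d6 < 6 /\ e6 < 6 by move: de; rewrite !inE => /or3P[] /eqP[-> ->].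
have /negP[] := refuteP (valuation ov [:: i; k; m] [:: c; p; q; r; s; n]) (three_row_refuted de).
apply: all_catI; first exact: (sat_fork rowsU colsU F).
apply: all_catI; first by rewrite all_seq1; apply: (sat_some_large _ _ _ _ (j := j)).
rewrite catA; apply: all_catI; first exact: sat_smalls.
rewrite catA; apply: all_catI; first exact: sat_smalls.
rewrite catA; apply: all_catI; first exact: sat_smalls.
exact: sat_pattern.
Qed.

(** Five distinct columns leave one more, [n]; the remaining claims follow from [fork_columns] for
    the fork and for its mirror image. *)
Lemma fork_extend t i k m p q r s c d e : uniq [:: i; k; m] ->
    fork t i k m p q r s c d e ->
  exists2 n, uniq [:: c; p; q; r; s; n] & d \in [:: r; s; n] /\ e \in [:: p; q; n].
Proof.
move=> + F; rewrite /= !inE negb_or => /and3P[/andP[ik im] km _].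
have [cols dP] := fork_columns ovP ik im km F.
have ki : k != i by rewrite eq_sym.
have [_ eP] := fork_columns ovP ki km im (fork_swap F).
have [[|n [|n' s']] [U Z]] := extend_columns cols; move: Z => // _.
exists n => //; split; [have := all_columns U d | have := all_columns U e].
  by move: dP; rewrite !inE !negb_or => /and3P[/negPf-> /negPf-> /negPf->] /=.
move: eP; rewrite !inE !negb_or => /and3P[/negPf-> /negPf-> /negPf->] /=.
by rewrite orbA orbC.
Qed.

Lemma uniq_swapl (c p q r s n : 'I_6) :
  uniq [:: c; p; q; r; s; n] -> uniq [:: c; q; p; r; s; n].
Proof. by rewrite (@perm_uniq _ _ [:: c; p; q; r; s; n]) //; apply/permP => a /=; lia. Qed.

Lemma uniq_swapr (c p q r s n : 'I_6) :
  uniq [:: c; p; q; r; s; n] -> uniq [:: c; p; q; s; r; n].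
Proof. by rewrite (@perm_uniq _ _ [:: c; p; q; r; s; n]) //; apply/permP => a /=; lia. Qed.

Lemma uniq_swap (c p q r s n : 'I_6) :
  uniq [:: c; p; q; r; s; n] -> uniq [:: c; r; s; p; q; n].
Proof. by rewrite (@perm_uniq _ _ [:: c; p; q; r; s; n]) //; apply/permP => a /=; lia. Qed.

Lemma three_rows_fork i k m p q r s c d e : uniq [:: i; k; m] ->
    fork false i k m p q r s c d e ->
    small false i m -> small false k m -> small true i k ->
  small true i m.
Proof.
move=> rowsU F; have [n U [+ +]] := fork_extend rowsU F.
have de : d != e by case: F => /=; rewrite !inE => /and3P[_ -> _].
rewrite !inE => /or3P[] /eqP dE /or3P[] /eqP eE.
(* Exchanging [p] with [q] and [r] with [s] brings eight of the nine cases to the three refuted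
   ones; the last would make [d] and [e] equal. *)
- exact: (@three_rows_normal i k m p q r s n c d e 3 1).
- apply: (@three_rows_normal i k m q p r s n c d e 3 1) => //; first exact: uniq_swapl.
  exact: fork_swapl.
- exact: (@three_rows_normal i k m p q r s n c d e 3 5).
- apply: (@three_rows_normal i k m p q s r n c d e 3 1) => //; first exact: uniq_swapr.
  exact: fork_swapr.
- apply: (@three_rows_normal i k m q p s r n c d e 3 1) => //.
    exact/uniq_swapl/uniq_swapr.
  exact/fork_swapl/fork_swapr.
- apply: (@three_rows_normal i k m p q s r n c d e 3 5) => //; first exact: uniq_swapr.
  exact: fork_swapr.
- exact: (@three_rows_normal i k m p q r s n c d e 5 1).
- apply: (@three_rows_normal i k m q p r s n c d e 5 1) => //; first exact: uniq_swapl.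
  exact: fork_swapl.
- by rewrite dE eE eqxx in de.
Qed.

(** A one-element support means proportionality: the entries of row [m] in columns [c], [d], [e]
    recur in row [o] up to scalars. *)
Definition fork_copy m o t' d' e' c d e :=
  [/\ S false (o, t') m = [set c], S false (o, d') m = [set d] & S false (o, e') m = [set e]].

Lemma four_rows_normal i k m o p q r s c d e t' d' e' dd ee :
    uniq [:: i; k; m; o] -> uniq [:: c; p; q; r; s; t'] ->
    fork false i k m p q r s c d e -> fork_copy m o t' d' e' c d e ->
    (dd, ee) \in [:: ((3, 4), (1, 2)); ((3, 4), (5, 1)); ((3, 4), (1, 0));
                     ((3, 4), (5, 0)); ((5, 3), (1, 0))] ->
    [:: d; d'; e; e'] =
      [seq nth ord0 [:: c; p; q; r; s; t'] l | l <- [:: dd.1; dd.2; ee.1; ee.2]] ->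
  small true m o.
Proof.
move=> rowsU colsU F [St Sd Se] de -[dE d'E eE e'E].
apply: contraT => /smallPn[j large].
have lt6 : [/\ dd.1 < 6, dd.2 < 6, ee.1 < 6 & ee.2 < 6].
  by move: de; rewrite !inE => /or4P[||| /orP[]] /eqP[-> ->].
have [d6 d'6 e6 e'6] := lt6.
have /negP[] := refuteP (valuation ov [:: i; k; m; o] [:: c; p; q; r; s; t']) (four_row_refuted de).
apply: all_catI; first exact: (sat_fork rowsU colsU F).
apply: all_catI; first by apply: sat_exact => // z; rewrite St !inE.
apply: all_catI.
  by apply: sat_exact; rewrite //= ?d6 // /cell_at /= -d'E => z; rewrite Sd !inE dE.
apply: all_catI.
  by apply: sat_exact; rewrite //= ?e6 // /cell_at /= -e'E => z; rewrite Se !inE eE.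
apply: all_catI; first by rewrite all_seq1; apply: (sat_some_large _ _ _ _ (j := j)).
exact: sat_pattern.
Qed.

(** A second element of the support must be [d] by [pairs_agree]. *)
Lemma single_of_pair t i m o p c d x : small t i m -> small t i o -> small t o m ->
    S t (i, p) m = [set c; d] -> c != d -> c \in S t (o, x) m ->
  S t (o, x) m = [set c] \/ S t (o, x) m = [set c; d].
Proof.
move=> im io om Sp cd cx.
have [S1|/subsetPn[y yx yc]] := boolP (S t (o, x) m \subset [set c]); last first.
  have cy : c != y by move: yc; rewrite inE eq_sym.
  right; have Sx : S t (o, x) m = [set c; y] by apply: eq_pair; rewrite ?small_support.
  by rewrite (pairs_agree ovP io im om Sp Sx cd cy).
by left; apply/eqP; rewrite eqEsubset S1 sub1set.
Qed.

Lemma fork_copy_exists i k m o p q r s c d e : fork false i k m p q r s c d e ->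
    small false i m -> small false i o -> small false k m -> small false k o ->
    small false m o ->
  exists t' d' e', fork_copy m o t' d' e' c d e.
Proof.
move=> [cde _ [Sp _] [Sr _]] im io km ko mo; have om := small_sym ovP mo.
have [cd ce de] : [/\ c != d, c != e & d != e].
  by move: cde; rewrite /= !inE negb_or => /andP[/andP[? ?] /andP[? _]].
have cover x : exists y, x \in S false (o, y) m.
  by have [y] := support_neq0 ovP false (m, x) o; rewrite -support_sym //; exists y.
have [t' ct'] := cover c; have [d' dd'] := cover d; have [e' ee'] := cover e.
have St : S false (o, t') m = [set c].
  have [//|Std] := single_of_pair im io om Sp cd ct'.
  (* The support cannot be both [[set c; d]] and contained in [[set c; e]]. *)
  have [//|] := single_of_pair km ko om Sr ce ct'.
  by move/setP/(_ d); rewrite Std !inE eqxx orbT eq_sym (negbTE cd) (negbTE de).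
have rest y x l a : small false l m -> small false l o -> S false (l, a) m = [set c; x] ->
    c != x -> x \in S false (o, y) m -> S false (o, y) m = [set x].
  move=> lm lo Sa cx xy; rewrite setUC in Sa; rewrite eq_sym in cx.
  have [//|Sy] := single_of_pair lm lo om Sa cx xy.
  (* The entries at [t'] and [y] would be orthogonal with [c] as their only common column. *)
  have yt : t' != y.
    apply: contraTneq xy => <-; by rewrite St inE.
  have [|z zc] := orthogonal_common ovP (row_orthogonal ovP false o yt) ct'.
    by rewrite Sy !inE eqxx orbT.
  by rewrite St inE (negbTE zc).
exists t', d', e'; split => //.
  exact: (rest _ _ i p).
exact: (rest _ _ k r).
Qed.

Lemma single_column i m o y x a : i != o -> S false (o, y) m = [set x] ->
  x \in S false (i, a) m -> y != a.
Proof.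
move=> io Sy xa; rewrite eq_sym; apply: (overlap_columns ovP (t := false) io).
by apply: (single_common ovP xa) => [|z _]; rewrite Sy inE // => /eqP.
Qed.

Lemma fork_copy_columns i k m o p q r s c d e t' d' e' : uniq [:: i; k; m; o] ->
    fork false i k m p q r s c d e -> fork_copy m o t' d' e' c d e ->
  [/\ uniq [:: c; p; q; r; s; t'],
      d \in [:: r; s; t'], d' \in [:: c; r; s], d' != d & d' != e'].
Proof.
move=> rowsU F.
have [[ik im io] [km ko mo]] : [/\ i != k, i != m & i != o] /\ [/\ k != m, k != o & m != o].
  by move: rowsU; rewrite /= !inE !negb_or => /and4P[/and3P[-> -> ->] /andP[-> ->] -> _].
have [cols dP] := fork_columns ovP ik im km F.
case: (F) => cde _ [Sp Sq] [Sr Ss] [St Sd Se].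
have [cd ce de] : [/\ c != d, c != e & d != e].
  by move: cde; rewrite /= !inE negb_or => /andP[/andP[? ?] /andP[? _]].
have own y x : S false (o, y) m = [set x] -> y != x.
  move=> Sy; rewrite eq_sym; apply: (overlap_columns ovP (t := false) mo).
  by rewrite (ov_sym ovP) -mem_support Sy inE.
have U : uniq [:: c; p; q; r; s; t'].
  rewrite -[[:: c; p; q; r; s; t']]/(rcons [:: c; p; q; r; s] t') rcons_uniq cols andbT.
  rewrite !inE !negb_or (own _ _ St) (single_column (i := i) (a := p) io St) ?Sp ?inE ?eqxx //.
  rewrite (single_column (i := i) (a := q) io St) ?Sq ?inE ?eqxx //.
  rewrite (single_column (i := k) (a := r) ko St) ?Sr ?inE ?eqxx //.
  by rewrite (single_column (i := k) (a := s) ko St) ?Ss ?inE ?eqxx.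
have d't' : d' != t'.
  by apply: contraNneq cd => eq; apply/eqP/set1P; rewrite -Sd eq St inE.
have d'e' : d' != e'.
  by apply: contraNneq de => eq; apply/eqP/set1P; rewrite -Se -eq Sd inE.
have d'p : d' != p by apply: (single_column io Sd); rewrite Sp !inE eqxx orbT.
have d'q : d' != q by apply: (single_column io Sd); rewrite Sq !inE eqxx orbT.
split => //; last exact: own.
  have := all_columns U d; move: dP; rewrite !inE !negb_or.
  by case/and3P=> /negPf-> /negPf-> /negPf-> /=.
have := all_columns U d'; rewrite !inE (negPf d'p) (negPf d'q) (negPf d't') /=.
by rewrite orbF.
Qed.

(** Exchanging [r] and [s] halves the cases; those with [d = d'] are excluded because [(m, d)] and
    [(o, d')] overlap. *)
Lemma fork_copy_normal i k m o p q r s c d e t' d' e' : uniq [:: i; k; m; o] ->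
    fork false i k m p q r s c d e -> fork_copy m o t' d' e' c d e ->
  exists r' s', fork false i k m p q r' s' c d e /\
    (d, d') \in [:: (r', s'); (r', c); (t', r'); (t', c)].
Proof.
move=> rowsU F C; have [_ + + d'd _] := fork_copy_columns rowsU F C.
have Fr := fork_swapr F; rewrite !inE => /or3P[] /eqP dE /or3P[] /eqP d'E.
- by exists r, s; split; rewrite // !inE dE d'E eqxx ?orbT.
- by rewrite dE d'E eqxx in d'd.
- by exists r, s; split; rewrite // !inE dE d'E eqxx ?orbT.
- by exists s, r; split; rewrite // !inE dE d'E eqxx ?orbT.
- by exists s, r; split; rewrite // !inE dE d'E eqxx ?orbT.
- by rewrite dE d'E eqxx in d'd.
- by exists r, s; split; rewrite // !inE dE d'E eqxx ?orbT.
- by exists r, s; split; rewrite // !inE dE d'E eqxx ?orbT.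
- by exists s, r; split; rewrite // !inE dE d'E eqxx ?orbT.
Qed.

Lemma four_rows i k m o : uniq [:: i; k; m; o] ->
    small false i m -> small false i o -> small false k m -> small false k o ->
    small false m o -> ~~ small false i k ->
  small true m o.
Proof.
move=> rowsU im io km ko mo ik.
have [p0 [q0 [r0 [s0 [c [d [e F0]]]]]]] := fork_exists ovP im km ik.
have [t' [d' [e' C]]] := fork_copy_exists F0 im io km ko mo.
have rowsU' : uniq [:: k; i; m; o].
  by rewrite (@perm_uniq _ _ [:: i; k; m; o]) //; apply/permP => a /=; lia.
have C' : fork_copy m o t' e' d' c e d by case: C; split.
have [r [s [F1 dd]]] := fork_copy_normal rowsU F0 C.
have [p [q [F' ee]]] := fork_copy_normal rowsU' (fork_swap F1) C'.
have F := fork_swap F'.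
have [U _ _ _ d'e'] := fork_copy_columns rowsU F C.
have U' := uniq_swap U.
have de : d != e by case: F => /=; rewrite !inE => /and3P[_ -> _].
pose normal := @four_rows_normal i k m o p q r s c d e t' d' e'.
pose normal' := @four_rows_normal k i m o r s p q c e d t' e' d'.
(* Of the sixteen cases, [d != e] and [d' != e'] leave nine. Exchanging rows [i] and [k] reduces
   them to the five refuted ones. *)
move: dd ee; rewrite !inE => /or4P[] /eqP[dE d'E] /or4P[] /eqP[eE e'E];
  rewrite ?dE ?eE ?d'E ?e'E ?eqxx // in de d'e' *.
- by apply: (normal (3, 4) (1, 2)) => //; rewrite dE d'E eE e'E.
- by apply: (normal (3, 4) (1, 0)) => //; rewrite dE d'E eE e'E.
- by apply: (normal (3, 4) (5, 1)) => //; rewrite dE d'E eE e'E.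
- by apply: (normal (3, 4) (5, 0)) => //; rewrite dE d'E eE e'E.
- by apply: (normal' (3, 4) (1, 0)) => //; rewrite dE d'E eE e'E.
- by apply: (normal' (5, 3) (1, 0)) => //; rewrite dE d'E eE e'E.
- by apply: (normal' (3, 4) (5, 1)) => //; rewrite dE d'E eE e'E.
- by apply: (normal (5, 3) (1, 0)) => //; rewrite dE d'E eE e'E.
- by apply: (normal' (3, 4) (5, 0)) => //; rewrite dE d'E eE e'E.
Qed.

End ForkExclusion.

(** * One square is small on all pairs of rows *)

Lemma pattern_swap ov : pattern ov -> pattern (fun t => ov (~~ t)).
Proof.
case=> rfl sym line disj some many hall.
split=> [t|t|t|x y xy|t|t|t]; [exact: rfl|exact: sym|exact: line| |exact: some|exact: many|exact: hall].
by rewrite andbC; apply: disj.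
Qed.

Lemma three_rows_common ov i k m : pattern ov -> uniq [:: i; k; m] ->
    small ov false i m -> small ov false k m -> small ov true i k ->
    ~~ small ov false i k ->
  small ov true i m.
Proof.
move=> ovP rowsU im km ik /(fork_exists ovP im km)[p [q [r [s [c [d [e F]]]]]]].
exact: (three_rows_fork ovP rowsU F).
Qed.

(** If this fails, [two_rows] makes square [true] small on [i], [k] and square [false] small on [i],
    [m]. Whichever square is small on [k], [m] then contradicts [three_rows_common], if need be with
    the squares and the rows [k], [m] exchanged. *)
Lemma three_rows ov i k m : pattern ov -> uniq [:: i; k; m] ->
  ~~ small ov false i k -> small ov true i m.
Proof.
move=> ovP rowsU ik0.
have [ik [im km]] : i != k /\ i != m /\ k != m.
  by move: rowsU; rewrite /= !inE negb_or => /and3P[/andP[-> ->] ->].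
have ik1 : small ov true i k by have := two_rows ovP ik; rewrite (negPf ik0).
apply: contraT => im1.
have im0 : small ov false i m by have := two_rows ovP im; rewrite (negPf im1) orbF.
have /orP[km0|km1] := two_rows ovP km.
  by have := three_rows_common ovP rowsU im0 km0 ik1 ik0; rewrite (negPf im1).
have rowsU' : uniq [:: i; m; k].
  by rewrite (@perm_uniq _ _ [:: i; k; m]) //; apply/permP => a /=; lia.
have := three_rows_common (pattern_swap ovP) rowsU' ik1 (small_sym ovP km1) im0 im1.
by rewrite /small /= -/(small ov false i k) (negPf ik0).
Qed.

(** Colour a pair of rows by each square that is not small on it. No pair has both colours by
    [two_rows]; pairs of different colours cannot share a row by [three_rows], nor be disjoint by
    [four_rows]. So at most one colour occurs. *)
Lemma small_dichotomy ov : pattern ov -> exists t, forall i k, i != k -> small ov t i k.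
Proof.
move=> ovP.
have [all0|] := boolP [forall i, forall k, (i != k) ==> small ov false i k].
  by exists false => i k ik; move/forallP/(_ i)/forallP/(_ k): all0; rewrite ik.
move/forallPn=> [i /forallPn[k]]; rewrite negb_imply => /andP[ik ik0].
exists true => a b ab; apply: contraT => ab1.
have ki0 : ~~ small ov false k i by apply: contra ik0; apply: small_sym.
have ba1 : ~~ small ov true b a by apply: contra ab1; apply: small_sym.
have adjacent x y z : x != y -> x != z -> ~~ small ov false x y -> small ov true x z.
  move=> xy xz xy0; have [<-|yz] := eqVneq y z.
    by have := two_rows ovP xy; rewrite (negPf xy0).
  by apply: (three_rows ovP _ xy0); rewrite /= !inE negb_or xy xz yz.
have adjacent' x y z : x != y -> x != z -> y != z -> ~~ small ov true x y -> small ov false x z.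
  move=> xy xz yz xy1; apply: (three_rows (pattern_swap ovP) (k := y) _ xy1).
  by rewrite /= !inE negb_or xy xz yz.
have far x y : x != y -> ~~ small ov false x y -> a != x /\ b != x.
  move=> xy xy0; split.
    by apply: contraNneq ab1 => ax; rewrite ax in ab *; apply: adjacent xy _ xy0.
  by apply: contraNneq ba1 => bx; rewrite bx eq_sym in ab *; apply: adjacent xy _ xy0.
have ki : k != i by rewrite eq_sym.
have ba : b != a by rewrite eq_sym.
have [ai bi] := far i k ik ik0; have [ak bk] := far k i ki ki0.
have ab0 : small ov false a b by have := two_rows ovP ab; rewrite (negPf ab1) orbF.
have := @four_rows ov ovP i k a b; rewrite (negPf ab1); apply => //.
- by rewrite /= !inE !negb_or ik ab ![_ == a]eq_sym ![_ == b]eq_sym ai bi ak bk.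
- by apply: (small_sym ovP); apply: adjacent' ab1.
- by apply: (small_sym ovP); apply: adjacent' ba1.
- by apply: (small_sym ovP); apply: adjacent' ab1.
- by apply: (small_sym ovP); apply: adjacent' ba1.
Qed.

(** * Hermitian products *)

Local Open Scope ring_scope.

Lemma cdotC m (u v : 'rV[Cplx]_m) : (cdot u v)^* = cdot v u.
Proof.
rewrite /cdot rmorph_sum; apply: eq_bigr => k _.
by rewrite rmorphM /= conjCK mulrC.
Qed.

Lemma cdot_neq0C m (u v : 'rV[Cplx]_m) : (cdot u v != 0) = (cdot v u != 0).
Proof. by rewrite -cdotC conjC_eq0. Qed.

Lemma cdot_sumr m (I : finType) (u : 'rV[Cplx]_m) (c : I -> Cplx) (f : I -> 'rV[Cplx]_m) :
  cdot u (\sum_i c i *: f i) = \sum_i c i * cdot u (f i).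
Proof.
rewrite /cdot; under eq_bigr do rewrite summxE mulr_sumr.
rewrite exchange_big /=; apply: eq_bigr => i _; rewrite mulr_sumr.
by apply: eq_bigr => k _; rewrite mxE mulrCA.
Qed.

Lemma parseval (I : finType) m (f : I -> 'rV[Cplx]_m) u v : is_onb f ->
  cdot u v = \sum_i cdot u (f i) * cdot (f i) v.
Proof.
case=> orth /(_ v)[c ->]; rewrite cdot_sumr; apply: eq_bigr => i _.
rewrite mulrC; congr (_ * _); rewrite cdot_sumr (bigD1 i) // orth eqxx mulr1.
rewrite [X in _ = _ + X]big1 ?addr0 // => j ji; by rewrite orth eq_sym (negPf ji) mulr0.
Qed.

Lemma cdot_ktens m n (u u' : 'rV[Cplx]_m) (v v' : 'rV[Cplx]_n) :
  cdot (ktens u v) (ktens u' v') = cdot u u' * cdot v v'.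
Proof.
rewrite /cdot mulr_sum; apply: eq_bigr => k _.
by rewrite !mxE !ord1 rmorphM /= mulrACA.
Qed.

(** Orthonormality makes the matrix of the vectors right invertible, so its rank is their number,
    which is the dimension. *)
Lemma orthonormal_onb (I : finType) m (f : I -> 'rV[Cplx]_m) : #|I| = m ->
  (forall i j, cdot (f i) (f j) = (i == j)%:R) -> is_onb f.
Proof.
move=> cardI orth; split => // v.
pose M : 'M[Cplx]_(#|I|, m) := \matrix_(i < #|I|) f (enum_val i).
pose N : 'M[Cplx]_(m, #|I|) := \matrix_(k < m, j < #|I|) (f (enum_val j) 0 k)^*.
have MN : M *m N = 1%:M.
  apply/matrixP=> i j; rewrite !mxE; under eq_bigr do rewrite !mxE mulrC.
  by rewrite -[LHS]/(cdot _ _) orth (inj_eq enum_val_inj) eq_sym.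
have full : row_full M.
  rewrite /row_full eqn_leq rank_leq_col /= -{1}cardI -{1}(mxrank1 Cplx #|I|) -MN.
  exact: mxrankM_maxl.
have /submxP[D ->] := submx_full v full.
exists (fun i => D 0 (enum_rank i)); rewrite mulmx_sum_row.
rewrite (reindex enum_rank) /=; last by apply: onW_bij; apply: enum_rank_bij.
by apply: eq_bigr => i _; rewrite rowK enum_rankK.
Qed.

Lemma sum_neq0 (I : finType) (F : I -> Cplx) : \sum_i F i != 0 -> exists i, F i != 0.
Proof.
move=> F0; apply/existsP; apply: contraNT F0 => /existsPn F0.
by rewrite big1 // => i _; apply/eqP; have := F0 i; rewrite negbK.
Qed.

(** Otherwise the Gram matrix of the three vectors, the identity of size 3, would factor through
    dimension 2. *)
Lemma hall_pair (I : finType) m (f : I -> 'rV[Cplx]_m) (x : 'I_3 -> 'rV[Cplx]_m) d e :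
    is_onb f -> (forall a b, cdot (x a) (x b) = (a == b)%:R) ->
  exists a i, i \notin [:: d; e] /\ cdot (x a) (f i) != 0.
Proof.
move=> fP orth.
have [/existsP[a /existsP[i /andP[ide xi]]]|none] :=
  boolP [exists a, exists i, (i \notin [:: d; e]) && (cdot (x a) (f i) != 0)].
  by exists a, i.
have x0 a i : i != d -> i != e -> cdot (x a) (f i) = 0.
  move=> id ie; apply/eqP; apply: contraNT none => xi.
  by apply/existsP; exists a; apply/existsP; exists i; rewrite !inE negb_or id ie.
(* The factor [*+ (d != e)] keeps a single term from being counted twice when [d = e]. *)
pose M : 'M[Cplx]_(3, 2) :=
  \matrix_(a, l) if l == 0 then cdot (x a) (f d) else cdot (x a) (f e) *+ (d != e).
pose N : 'M[Cplx]_(2, 3) :=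
  \matrix_(l, a) if l == 0 then cdot (f d) (x a) else cdot (f e) (x a).
have MN : M *m N = 1%:M.
  apply/matrixP=> a b; rewrite mxE [RHS]mxE -orth (parseval _ _ fP) big_ord_recl big_ord1.
  rewrite [RHS](bigD1 d) // !mxE eqxx (_ : (lift ord0 ord0 == 0 :> 'I_2) = false) //.
  congr (_ + _); case: eqVneq => [de|de].
    by rewrite mulr0n mul0r big1 // => i id; rewrite x0 -?de ?mul0r.
  rewrite [RHS](bigD1 e) 1?eq_sym // mulr1n [X in _ = _ + X]big1 ?addr0 // => i /andP[id ie].
  by rewrite x0 ?mul0r.
have := mxrankM_maxl M N; rewrite MN mxrank1 leqNgt.
by rewrite (leq_ltn_trans (rank_leq_col M)).
Qed.

Definition overlap (Psi : bool -> 'I_6 -> 'I_6 -> 'rV[Cplx]_6) t (x y : 'I_6 * 'I_6) : bool :=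
  cdot (Psi t x.1 x.2) (Psi t y.1 y.2) != 0.

(** Expansion along row [i] gives [ov_some], as a nonzero sum has a nonzero term, and [ov_many], as
    a zero sum with a nonzero term has another one. For [ov_disjoint], inner products of tensors
    factor. *)
Lemma overlap_pattern Psi : (forall t, QLS (Psi t)) ->
  orthogonal_QLS (Psi false) (Psi true) -> pattern (overlap Psi).
Proof.
move=> PsiP [orth _].
have unit t i j : cdot (Psi t i j) (Psi t i j) = 1 := (PsiP t).1 i j.
have rowP t i : is_onb (Psi t i) := (PsiP t).2.1 i.
have colP t j : is_onb (Psi t ^~ j) := (PsiP t).2.2 j.
split.
- by move=> t x; rewrite /overlap unit oner_neq0.
- by move=> t x y; rewrite /overlap cdot_neq0C.
- move=> t [i j] [k l] /= xy /orP[] /eqP ?; subst.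
    rewrite negbK (rowP t k).1 (_ : j == l = false) //.
    by apply: contraNF xy => /eqP->.
  rewrite negbK (colP t l).1 (_ : i == k = false) //.
  by apply: contraNF xy => /eqP->.
- move=> x y xy; rewrite -negb_or negbK -mulf_eq0 -cdot_ktens.
  by rewrite (orth x y) (negPf xy).
- move=> t x y i; rewrite /overlap (parseval _ _ (rowP t i)) => /sum_neq0[c].
  by rewrite mulf_eq0 negb_or => /andP[xc cy]; exists c; rewrite xc cdot_neq0C.
- move=> t x y i c; rewrite /overlap negbK (parseval _ _ (rowP t i)) => + xc yc.
  rewrite (bigD1 c) //= addrC addr_eq0 => /eqP sumE.
  have : \sum_(j | j != c) cdot (Psi t x.1 x.2) (Psi t i j) * cdot (Psi t i j) (Psi t y.1 y.2) != 0.
    by rewrite sumE oppr_eq0 mulf_neq0 // cdot_neq0C.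
  rewrite big_mkcond => /sum_neq0[d]; case: ifP; rewrite ?eqxx // => dc.
  by rewrite mulf_eq0 negb_or => /andP[xd dy]; exists d; rewrite // xd cdot_neq0C.
- move=> t i k a b c d e abc.
  pose x (l : 'I_3) := Psi t i (nth a [:: a; b; c] l).
  have [|l [f [fde xf]]] := @hall_pair _ _ (Psi t k) x d e (rowP t k).
    by move=> l l'; rewrite (rowP t i).1 nth_uniq.
  by exists (nth a [:: a; b; c] l), f; split; rewrite // mem_nth.
Qed.

(** * Rounding a square with small supports to a Latin square *)

(** A half-plane with half of its boundary line, so that it contains exactly one of [z] and [- z]
    for nonzero [z]. *)
Definition upper_half (z : Cplx) := (0 < 'Im z) || ('Im z == 0) && (0 < 'Re z).

(* Selects one of any two orthogonal lines of C^2: in the coordinate z = a / b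
   orthogonality is z |-> - 1 / z^*, which exchanges the inside and the outside
   of the unit circle and the two halves of the circle itself. *)
Definition upper_line (a b : Cplx) :=
  (`|b| < `|a|) || (`|a| == `|b|) && upper_half (a * b^*).

Lemma upper_half_scale r z : 0 < r -> upper_half (r * z) = upper_half z.
Proof.
move=> r0; have rR : r \is Num.real by apply: gtr0_real.
by rewrite /upper_half ImMl // ReMl // !pmulr_rgt0 // mulf_eq0 (gt_eqF r0).
Qed.

Lemma upper_halfN z : z != 0 -> upper_half (- z) = ~~ upper_half z.
Proof.
move=> z0; rewrite /upper_half !raddfN /= !oppr_gt0 oppr_eq0.
have [||Im0] := real_ltgtP (Creal_Im z) (real0 _); rewrite //= ?orbF //.
have [||Re0] := real_ltgtP (Creal_Re z) (real0 _); rewrite //=.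
by move: z0; rewrite [z]Crect Im0 Re0 mulr0 addr0 eqxx.
Qed.

(** Taking norms in the orthogonality relation gives [|a| |a'| = |b| |b'|], so the comparison of the
    two coordinates is reversed. If the norms are equal, [a' * b'^*] is a negative multiple of
    [a * b^*]. *)
Lemma upper_line_orthogonal a b a' b' : a != 0 -> b != 0 -> a' != 0 -> b' != 0 ->
  a^* * a' + b^* * b' = 0 -> upper_line a' b' = ~~ upper_line a b.
Proof.
move=> a0 b0 a'0 b'0 /eqP; rewrite addr_eq0 => /eqP aa'.
have normE : `|a| * `|a'| = `|b| * `|b'|.
  by rewrite -(norm_conjC a) -(norm_conjC b) -!normrM aa' normrN.
have [an bn a'n b'n] : [/\ 0 < `|a|, 0 < `|b|, 0 < `|a'| & 0 < `|b'|] by rewrite !normr_gt0.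
rewrite /upper_line; have [lt_ab|lt_ba|eq_ab] := real_ltgtP (normr_real a) (normr_real b).
- have lt : `|b'| < `|a'|.
    by rewrite -(ltr_pM2l bn) -normE ltr_pM2r.
  by rewrite lt.
- have lt : `|a'| < `|b'|.
    by rewrite -(ltr_pM2l bn) -normE ltr_pM2r.
  by rewrite (lt_gtF lt) (lt_eqF lt).
have eq_ab' : `|a'| = `|b'| by apply: (mulfI (lt0r_neq0 bn)); rewrite -normE eq_ab.
rewrite eq_ab' ltxx eqxx /=.
have zE : `|a| ^+ 2 * (a' * b'^*) = - (`|b'| ^+ 2 * (a * b^*)).
  by rewrite normCK normCK -mulrA [a^* * _]mulrA aa'; ring.
rewrite -(upper_half_scale _ (exprn_gt0 2 an)) zE upper_halfN.
  by rewrite (upper_half_scale _ (exprn_gt0 2 b'n)).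
by rewrite mulf_neq0 ?expf_neq0 ?normr_eq0 ?mulf_neq0 ?conjC_eq0.
Qed.

Section Rounding.
Variables (Psi : bool -> 'I_6 -> 'I_6 -> 'rV[Cplx]_6) (t : bool).
Hypotheses (PsiP : forall t, QLS (Psi t)) (orth : orthogonal_QLS (Psi false) (Psi true)).
Hypothesis Psi_small : forall i k, i != k -> small (overlap Psi) t i k.

Let ovP : pattern (overlap Psi) := overlap_pattern PsiP orth.
Let S x := row_support (overlap Psi) t x ord0.
Let coefficient (x : 'I_6 * 'I_6) j := cdot (Psi t ord0 j) (Psi t x.1 x.2).

Lemma coefficient_neq0 x j : (coefficient x j != 0) = (j \in S x).
Proof. by rewrite inE /coefficient cdot_neq0C. Qed.

Lemma top_support j : S (ord0, j) = [set j].
Proof.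
apply/setP=> c; rewrite !inE; have [->|cj] := eqVneq c j; first exact: (ov_refl ovP).
by apply/negbTE/(row_orthogonal ovP); rewrite eq_sym.
Qed.

Lemma support_le2 x : (#|S x| <= 2)%N.
Proof.
case: x => i j; have [->|i0] := eqVneq i ord0; first by rewrite top_support cards1.
exact/small_support/Psi_small.
Qed.

(** This is the splitting into blocks: two-element supports that meet coincide. For different rows
    it is [pairs_agree]; within a row, orthogonal entries cannot share just one column. *)
Lemma support_agree x y c : c \in S x -> c \in S y -> #|S x| = 2%N -> #|S y| = 2%N -> S x = S y.
Proof.
have row_neq0 z : #|S z| = 2%N -> z.1 != ord0.
  by case: z => i j Sz; apply: contra_eq_neq Sz => /= ->; rewrite top_support cards1.
have pair z : c \in S z -> #|S z| = 2%N -> exists2 d, c != d & S z = [set c; d].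
  move=> cz Sz; have : (1 < #|S z|)%N by rewrite Sz.
  case/card_gt1P=> u [w [uz wz uw]]; have [cu|cu] := eqVneq c u.
    by exists w; rewrite ?cu //; apply: eq_pair => //; rewrite Sz.
  by exists u; rewrite //; apply: eq_pair => //; rewrite Sz.
move=> cx cy Sx Sy; have [d cd SxE] := pair x cx Sx; have [e ce SyE] := pair y cy Sy.
rewrite SxE SyE; suff -> : d = e by [].
have [x0 y0] := (row_neq0 x Sx, row_neq0 y Sy).
case: x y => [i a] [k b] /= in cx cy Sx Sy SxE SyE x0 y0 *.
have [ik|ik] := eqVneq i k; last first.
  exact: (pairs_agree ovP (Psi_small ik) (Psi_small x0) (Psi_small y0) SxE SyE).
rewrite {i}ik in cx Sx SxE x0 *.
have [ab|ab] := eqVneq a b.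
  have : e \in S (k, a) by rewrite ab SyE !inE eqxx orbT.
  by rewrite SxE !inE eq_sym (negPf ce) => /eqP.
have [f fc /andP[]] := orthogonal_common ovP (row_orthogonal ovP t k ab) cx cy.
by rewrite -/(S _) -/(S _) SxE SyE !inE (negPf fc) => /eqP-> /eqP.
Qed.

Let first (A : {set 'I_6}) := odflt ord0 [pick c in A].
Let second (A : {set 'I_6}) := first (A :\ first A).

(** The order of the two coordinates depends on the support alone, so entries of one block are
    compared in the same coordinates. For a one-element support [k] is only a default value, and the
    test on the cardinal selects [j]. *)
Definition color (x : 'I_6 * 'I_6) : 'I_6 :=
  let j := first (S x) in let k := second (S x) in
  if (#|S x| == 1)%N || upper_line (coefficient x j) (coefficient x k) then j else k.

Lemma first_in (A : {set 'I_6}) : A != set0 -> first A \in A.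
Proof. by case/set0Pn=> x xA; rewrite /first; case: pickP => [//|/(_ x)]; rewrite xA. Qed.

Lemma first_second (A : {set 'I_6}) : #|A| = 2%N -> first A != second A /\ A = [set first A; second A].
Proof.
move=> A2; have A0 : A != set0 by rewrite -card_gt0 A2.
have fA := first_in A0.
have D1 : #|A :\ first A| = 1%N by have := cardsD1 (first A) A; rewrite A2 fA => -[].
have sD : second A \in A :\ first A by apply: first_in; rewrite -card_gt0 D1.
move: sD; rewrite !inE => /andP[sf sA]; rewrite eq_sym; split => //.
by apply: eq_pair => //; rewrite ?A2 // eq_sym.
Qed.

Lemma support_card x : #|S x| = 1%N \/ #|S x| = 2%N.
Proof.
have : (0 < #|S x|)%N by rewrite card_gt0; apply/set0Pn/(support_neq0 ovP).
by have := support_le2 x; case: #|S x| => [|[|[|]]] // _ _; [left | right].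
Qed.

Lemma color_in x : color x \in S x.
Proof.
rewrite /color; have [x1|x2] := support_card x.
  by rewrite x1 eqxx /=; apply: first_in; rewrite -card_gt0 x1.
rewrite x2 /=; have [_ E] := first_second x2.
by case: ifP => _; rewrite {2}E !inE eqxx ?orbT.
Qed.

Lemma cdot_coefficients x y : cdot (Psi t x.1 x.2) (Psi t y.1 y.2) =
  \sum_j (coefficient x j)^* * coefficient y j.
Proof.
rewrite (parseval _ _ ((PsiP t).2.1 ord0)); apply: eq_bigr => j _.
by rewrite /coefficient cdotC.
Qed.

(** If one of the supports is a singleton, it is the only common column. Otherwise both entries lie
    in one block, where orthogonal lines receive different symbols. *)
Lemma color_overlap x y : color x = color y -> overlap Psi t x y.
Proof.
move=> cxy; have cx := color_in x; have cy := color_in y; rewrite -cxy in cy.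
have single z w : color x \in S z -> color x \in S w -> #|S z| = 1%N -> overlap Psi t z w.
  move=> cz cw /eqP/cards1P[c Sz]; apply: (single_common ovP cz cw) => d.
  by rewrite -/(S z) Sz inE => /eqP-> _; move: cz; rewrite -/(S z) Sz inE => /eqP.
have [x1|x2] := support_card x; first exact: single.
have [y1|y2] := support_card y; first by rewrite (ov_sym ovP); apply: single.
have SE := support_agree cx cy x2 y2; have [jk SxE] := first_second x2.
move: cxy; rewrite /color x2 y2 /= -SE => cxy.
set j := first (S x) in jk SxE cxy *; set k := second (S x) in jk SxE cxy *.
apply: contraT; rewrite negbK cdot_coefficients.
have kj : k != j by rewrite eq_sym.
have -> : \sum_l (coefficient x l)^* * coefficient y l =
    (coefficient x j)^* * coefficient y j + (coefficient x k)^* * coefficient y k.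
  rewrite (bigD1 j) // (bigD1 k kj) -[X in _ = _ + X]addr0; congr (_ + (_ + _)).
  apply: big1 => l /andP[/andP[_ lj] lk].
  suff -> : coefficient x l = 0 by rewrite conjC0 mul0r.
  by apply/eqP; apply: contraT; rewrite coefficient_neq0 SxE !inE (negPf lj) (negPf lk).
move/eqP/upper_line_orthogonal=> up; move: cxy.
rewrite up ?coefficient_neq0 -?SE ?SxE ?inE ?eqxx ?orbT //.
by case: upper_line => /= E; rewrite E eqxx in jk.
Qed.

Lemma color_latin : latin_square (fun i j => color (i, j)).
Proof.
split=> [i|j]; apply: injF_bij => a b /color_overlap.
  by have [//|ab] := eqVneq a b; rewrite (negPf (row_orthogonal ovP t i ab)).
have [//|ab] := eqVneq a b; apply: contraTeq => _; apply: (ov_line ovP); last by rewrite eqxx orbT.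
by apply: contraNneq ab => -[->].
Qed.

Lemma rounding : exists Psi' Phi' : 'I_6 -> 'I_6 -> 'rV[Cplx]_6,
  QLS Psi' /\ QLS Phi' /\ orthogonal_QLS Psi' Phi' /\ classical_QLS Psi'.
Proof.
pose e := Psi t ord0; pose Psi' i j := e (color (i, j)).
have eP : is_onb e := (PsiP t).2.1 ord0.
have [rowsL colsL] := color_latin.
exists Psi', (Psi (~~ t)); split; last (split; last split) => //.
- split=> [i j|]; first by rewrite /unit_vec eP.1 eqxx.
  split=> [i|j]; apply: orthonormal_onb; rewrite ?card_ord // => a b; rewrite eP.1.
    by rewrite (inj_eq (bij_inj (rowsL i))).
  by rewrite (inj_eq (bij_inj (colsL j))).
- apply: orthonormal_onb; first by rewrite card_prod !card_ord.
  move=> x y; rewrite cdot_ktens eP.1.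
  have [<-|xy] := eqVneq x y; first by rewrite eqxx mul1r; apply: (PsiP (~~ t)).1.
  case: eqVneq => [cxy|_]; last by rewrite mul0r.
  (* Distinct cells with equal symbols overlap in square [t], so they are orthogonal in the other
     square. *)
  have ovt : overlap Psi t x y by apply: color_overlap; case: (x) (y) cxy => [? ?] [].
  have : ~~ overlap Psi (~~ t) x y.
    have := ov_disjoint ovP xy; move: ovt; case: (t) => /= -> //.
    by rewrite andbT.
  by rewrite negbK mul1r => /eqP.
- by exists e, (fun i j => color (i, j)); split=> //; split=> // i j; exists 1; rewrite scale1r.
Qed.

End Rounding.

Local Close Scope ring_scope.

Theorem mainTheorem10 :
  (exists Psi Phi : 'I_6 -> 'I_6 -> 'rV[Cplx]_6,
      QLS Psi /\ QLS Phi /\ orthogonal_QLS Psi Phi) ->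
  exists Psi Phi : 'I_6 -> 'I_6 -> 'rV[Cplx]_6,
      QLS Psi /\ QLS Phi /\ orthogonal_QLS Psi Phi /\ classical_QLS Psi.
Proof.
move=> [Psi [Phi [PsiP [PhiP orth]]]].
pose F t := if t then Phi else Psi.
have FP t : QLS (F t) by case: t.
have [t F_small] := small_dichotomy (overlap_pattern FP orth).
exact: rounding FP orth F_small.
Qed.
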